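(* Each element $\mathcal{A}\in\mathcal{C}(Q)$ can be written in the form $$\mathcal{A}=R_{d_1}*\cdots*R_{d_s},$$ where each $d_k\in\mathbf{N}I$ is a Schur root, and for all $k=1,\ldots,s-1$, $$\mathrm{ext}(d_k,d_{k+1})\ne0\quad\text{implies}\quad\mathrm{ext}(d_{k+1},d_k)\ne0.$$
   Context: The ground field $K$ is algebraically closed of characteristic $0$, and $Q$ is a finite quiver without oriented cycles with vertex set $I$. $\mathbf{N}I$ is the set of vectors with nonnegative integer coordinates in the free abelian group on symbols $\sigma_i$ ($i\in I$). The Euler form is $\langle d,e\rangle=\sum_{i\in I}d_ie_i-\sum_{i\to j}d_ie_j$ (second sum over all arrows of $Q$). For $d\in\mathbf{N}I$, $R_d=\bigoplus_{\alpha:i\to j}\mathrm{Hom}_K(K^{d_i},K^{d_j})$ is the affine variety of representations of $Q$ of dimension vector $d$. For $\mathcal{A}\subset R_d$, $\mathcal{B}\subset R_e$, the set $\mathcal{A}*\mathcal{B}\subset R_{d+e}$ consists of all $X\in R_{d+e}$ for which there is an exact sequence of representations $0\to N\to X\to M\to 0$ with $M\in\mathcal{A}$, $N\in\mathcal{B}$. This operation is associative. The composition monoid $\mathcal{C}(Q)$ is the monoid, under $*$ and with unit $R_0$ (the empty product), generated by the $R_{\sigma_i}$, $i\in I$; all $R_d$ belong to $\mathcal{C}(Q)$. For $d,e\in\mathbf{N}I$, $\mathrm{ext}(d,e):=\min\{\dim_K\mathrm{Hom}_{KQ}(A,B): A\in R_d,\,B\in R_e\}-\langle d,e\rangle$.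 A dimension vector $d\in\mathbf{N}I$ is a Schur root if there is a representation $X\in R_d$ with $\mathrm{End}_{KQ}(X)\simeq K$. *)

(* Defs.v *)
From HB Require Import structures.
From mathcomp Require Import all_boot all_order all_algebra.
From mathcomp Require Import boolp classical_sets.

Set Implicit Arguments.
Unset Strict Implicit.
Unset Printing Implicit Defensive.

Import GRing.Theory.
Local Open Scope ring_scope.

(* The finite-dimensional vector space of families of matrices of varying     *)
(* sizes; both the representation spaces R_d and the spaces                   *)
(* \bigoplus_i Hom(K^{d_i}, K^{e_i}) are of this form.                        *)
Definition mxfam (K : fieldType) (J : finType) (m n : J -> nat) : predArgType :=
  {dffun forall j : J, 'M[K]_(m j, n j)}.

Section MatrixFamilies.
Variables (K : fieldType) (J : finType) (m n : J -> nat).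
Local Notation V := (mxfam K m n).

HB.instance Definition _ := Choice.on V.

Definition mxfam0 : V := [ffun j => 0].
Definition mxfam_opp (f : V) : V := [ffun j => - f j].
Definition mxfam_add (f g : V) : V := [ffun j => f j + g j].
Definition mxfam_scale (c : K) (f : V) : V := [ffun j => c *: f j].

Fact mxfam_addA : associative mxfam_add.
Proof. by move=> f g h; apply/ffunP=> j; rewrite !ffunE addrA. Qed.
Fact mxfam_addC : commutative mxfam_add.
Proof. by move=> f g; apply/ffunP=> j; rewrite !ffunE addrC. Qed.
Fact mxfam_add0 : left_id mxfam0 mxfam_add.
Proof. by move=> f; apply/ffunP=> j; rewrite !ffunE add0r. Qed.
Fact mxfam_addN : left_inverse mxfam0 mxfam_opp mxfam_add.
Proof. by move=> f; apply/ffunP=> j; rewrite !ffunE addNr. Qed.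

HB.instance Definition _ := GRing.isZmodule.Build V
  mxfam_addA mxfam_addC mxfam_add0 mxfam_addN.

Fact mxfam_scaleA a b (f : V) :
  mxfam_scale a (mxfam_scale b f) = mxfam_scale (a * b) f.
Proof. by apply/ffunP=> j; rewrite !ffunE scalerA. Qed.
Fact mxfam_scale1 : left_id 1 mxfam_scale.
Proof. by move=> f; apply/ffunP=> j; rewrite !ffunE scale1r. Qed.
Fact mxfam_scaleDr : right_distributive mxfam_scale +%R.
Proof. by move=> a f g; apply/ffunP=> j; rewrite !ffunE scalerDr. Qed.
Fact mxfam_scaleDl (f : V) :
  {morph mxfam_scale^~ f : a b / a + b}.
Proof. by move=> a b; apply/ffunP=> j; rewrite !ffunE scalerDl. Qed.

HB.instance Definition _ := GRing.Zmodule_isLmodule.Build K V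
  mxfam_scaleA mxfam_scale1 mxfam_scaleDr mxfam_scaleDl.

Lemma mxfamDE (f g : V) j : (f + g) j = f j + g j.
Proof. exact: ffunE. Qed.
Lemma mxfamZE c (f : V) j : (c *: f) j = c *: f j.
Proof. exact: ffunE. Qed.

Local Notation entry := {j : J & ('I_(m j) * 'I_(n j))%type}.

Fact mxfam_vect_iso : Vector.axiom #|{: entry}| V.
Proof.
pose fr (f : V) : 'rV[K]_#|{: entry}| :=
  \row_k (f (tag (enum_val k)) (tagged (enum_val k)).1
            (tagged (enum_val k)).2).
pose gr (r : 'rV[K]_#|{: entry}|) : V :=
  [ffun j => \matrix_(x, y)
     r 0 (enum_rank (Tagged (fun j => ('I_(m j) * 'I_(n j))%type) (x, y)))].
exists fr.
  by move=> a f g; apply/rowP=> k; rewrite !mxE mxfamDE mxfamZE !mxE.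
exists gr => [f | r].
  by apply/ffunP=> j; rewrite ffunE; apply/matrixP=> x y; rewrite !mxE enum_rankK.
apply/rowP=> k; rewrite !mxE ffunE !mxE -[in RHS](enum_valK k).
by case: (enum_val k) => j [].
Qed.

HB.instance Definition _ := Lmodule_hasFinDim.Build K V mxfam_vect_iso.

End MatrixFamilies.

Record quiver := Quiver {
  vertex : finType;
  arrow : finType;
  src : arrow -> vertex;
  tgt : arrow -> vertex }.

Definition arrow_rel (Q : quiver) : rel (vertex Q) :=
  fun i j => [exists a : arrow Q, (src a == i) && (tgt a == j)].

Definition no_oriented_cycle (Q : quiver) : Prop :=
  forall (i : vertex Q) (p : seq (vertex Q)),
    path (@arrow_rel Q) i p -> last i p = i -> p = [::].

Definition dimvec (Q : quiver) := {ffun vertex Q -> nat}.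

HB.instance Definition _ Q := GRing.Nmodule.on (dimvec Q).

Definition sigma (Q : quiver) (i : vertex Q) : dimvec Q :=
  [ffun j => (j == i) : nat].

Definition euler (Q : quiver) (d e : dimvec Q) : int :=
  \sum_(i : vertex Q) (d i * e i)%:Z
  - \sum_(a : arrow Q) (d (src a) * e (tgt a))%:Z.

(* As usual in MathComp, matrices act on row vectors from the right, so       *)
(* Hom(K^m, K^n) is 'M[K]_(m, n) and "f, then g" is f *m g.                   *)
Definition rep (K : fieldType) (Q : quiver) (d : dimvec Q) : predArgType :=
  mxfam K (fun a : arrow Q => d (src a)) (fun a => d (tgt a)).

HB.instance Definition _ K Q d := Vector.on (@rep K Q d).

Definition vmap (K : fieldType) (Q : quiver) (d e : dimvec Q) : predArgType :=
  mxfam K d e.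

HB.instance Definition _ K Q d e := Vector.on (@vmap K Q d e).

Section Representations.
Variables (K : fieldType) (Q : quiver).
Implicit Types d e : dimvec Q.

Definition vmap_id d : vmap K d d := [ffun i => 1%:M].

Definition vmap_comp d e c (f : vmap K d e) (g : vmap K e c) : vmap K d c :=
  [ffun i => f i *m g i].

Definition defect d e (A : rep K d) (B : rep K e) (f : vmap K d e) :
    mxfam K (fun a : arrow Q => d (src a)) (fun a => e (tgt a)) :=
  [ffun a => A a *m f (tgt a) - f (src a) *m B a].

Fact defect_is_linear d e (A : rep K d) (B : rep K e) : linear (defect A B).
Proof.
move=> c f g; apply/ffunP=> a; rewrite mxfamDE mxfamZE !ffunE.
by rewrite mulmxDr mulmxDl -scalemxAr -scalemxAl scalerBr addrACA opprD.
Qed.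

HB.instance Definition _ d e (A : rep K d) (B : rep K e) :=
  GRing.isLinear.Build K (vmap K d e) _ _ (defect A B) (defect_is_linear A B).

Definition hom d e (A : rep K d) (B : rep K e) : {vspace vmap K d e} :=
  lker (linfun (defect A B)).

Lemma homP d e (A : rep K d) (B : rep K e) (f : vmap K d e) :
  reflect (forall a, A a *m f (tgt a) = f (src a) *m B a) (f \in hom A B).
Proof.
rewrite memv_ker lfunE; apply: (iffP eqP) => [/ffunP fAB a | fAB].
  by have := fAB a; rewrite !ffunE => /eqP; rewrite subr_eq0 => /eqP.
by apply/ffunP=> a; rewrite !ffunE fAB subrr.
Qed.

Definition exact_seq e c d (N : rep K e) (X : rep K c) (M : rep K d) : Prop :=
  exists f g, [/\ f \in hom N X, g \in hom X M
    & forall i, [/\ row_free (f i), (f i == kermx (g i))%MS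
                  & row_full (g i)]].

(* End(X) is isomorphic to K as a K-algebra. *)
Definition end_iso_K d (X : rep K d) : Prop :=
  exists f : {linear K^o -> vmap K d d},
    [/\ injective f,
        forall g, g \in hom X X <-> exists c, g = f c,
        f 1 = vmap_id d
      & forall a b : K, f (a * b) = vmap_comp (f a) (f b)].

Definition Schur_root d : Prop := exists X : rep K d, end_iso_K X.

Definition hom_dim d e : pred nat :=
  fun k => `[< exists (A : rep K d) (B : rep K e), k = \dim (hom A B) >].

Fact hom_dim_ex d e : exists k, hom_dim d e k.
Proof.
by exists (\dim (hom (0 : rep K d) (0 : rep K e))); apply/asboolP; exists 0, 0.
Qed.

Definition min_hom d e : nat := ex_minn (hom_dim_ex d e).

Definition ext d e : int := (min_hom d e)%:Z - euler d e.

(* A subset of some R_d, together with the dimension vector d. *)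
Definition repset := {d : dimvec Q & set (rep K d)}.

Definition fullR d : repset := existT _ d [set: rep K d]%classic.

Definition star (A B : repset) : repset :=
  existT _ (projT1 A + projT1 B)
    [set X | exists M N, [/\ projT2 A M, projT2 B N & exact_seq N X M]]%classic.

Inductive comp_monoid : repset -> Prop :=
  | comp_monoid_one : comp_monoid (fullR 0)
  | comp_monoid_gen i : comp_monoid (fullR (sigma i))
  | comp_monoid_star A B :
      comp_monoid A -> comp_monoid B -> comp_monoid (star A B).

End Representations.

Arguments Schur_root K {Q} d.
Arguments ext K {Q} d e.
Arguments fullR K {Q} d.
Arguments comp_monoid {K Q} A.

(* Main.v *)
From HB Require Import structures.
From mathcomp Require Import all_boot all_order all_algebra.
From mathcomp Require Import boolp classical_sets.
Require Import Defs.
Set Implicit Arguments.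
Unset Strict Implicit.
Unset Printing Implicit Defensive.
Import Order.TTheory GRing.Theory Num.Theory.
Local Open Scope ring_scope.

(** Call a list of nonzero dimension vectors d_1, ..., d_s a word for the
    product R_{d_1} * ... * R_{d_s}.  Elements of the monoid are given by words
    in the sigma_i, and two moves change a word but not its product: merging
    neighbours d, e into d + e when ext(e, d) = 0, and splitting a letter
    d = b + c into b, c when ext(b, c) = ext(c, b) = 0.  Both rest on
    [star_full]: R_d * R_e = R_{d+e} when ext(e, d) = 0.

    Let [total_ext] be the sum of ext(d_k, d_l) over all k <> l, the codimension
    of the family of direct sums of representations of dimensions d_1, ..., d_s.
    Merging with ext(d, e) <> 0 makes it drop, because ext is subadditive and
    the pair (d, e) disappears; splitting preserves it, because ext is additive
    on b + c, and makes the word longer.  A word that minimizes [total_ext] and,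
    among the minimizers, has maximal length allows neither move.  That is the
    condition on neighbours, and its letters are Schur roots since a nonzero
    vector that is not a Schur root can be split ([schur_split]).

    Three facts about general representations are used.

    [subrep_of_ext0] (Schofield): if Ext(N, M) = 0 for some N, M of dimensions
    e, c, then every X of dimension e + c has a subrepresentation of dimension
    e.  On the line from N + M (at t = 0) to X (at t = 1), the subrepresentation
    N extends over formal power series in t, since obstructions lie in
    Ext(N, M).  A place of the field of Laurent series with values in K that
    sends t to 1 ([place_extension]) then carries it to X, since Grassmannians
    are proper ([specialize_subrep]).

    [extDl_le] and [extDl] with their duals: a generic representation of
    dimension b + c has Hom spaces at most as large as the sum of two generic
    ones; if ext(b, c) = ext(c, b) = 0 then it is such a sum.  Genericity is
    always tested on a line, where a nonempty open set is the complement of the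
    zeros of a nonzero polynomial.

    [schur_split] (Kac): choose X with the smallest endomorphism ring, so that
    every endomorphism f of X deforms along every line through X.  If f can be
    deformed without changing its rank then so can ker f and im f, which forces
    Ext(ker f, X / ker f) = Ext(im f, X / im f) = 0 ([ext0_of_lifts]); the
    dimensions of ker f and im f split d.  Nontrivial idempotents have constant
    rank under deformation.  If there are none, traceless endomorphisms are
    nilpotent in characteristic 0, and one of maximal rank will do. *)

(** * Split short exact sequences of vector spaces *)
Section Biproducts.
Variable F : fieldType.

(** The identities of a biproduct decomposition K^d = K^e + K^c; matrices act
    from the right, so f includes the subspace and g projects to the quotient.
    A complement given by equations is easier to rewrite with than ranks and
    kernels. *)
Definition biprod e d c (f : 'M[F]_(e, d)) (f' : 'M_(d, e)) (g : 'M_(d, c))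
    (g' : 'M_(c, d)) : Prop :=
  [/\ f *m f' = 1%:M, g' *m g = 1%:M, f *m g = 0, g' *m f' = 0
    & f' *m f + g *m g' = 1%:M].

Lemma biprod_row_free e d c (f : 'M[F]_(e, d)) f' (g : 'M_(d, c)) g' :
  biprod f f' g g' -> row_free f.
Proof. by case=> h _ _ _ _; apply/row_freeP; exists f'. Qed.

Lemma biprod_row_full e d c (f : 'M[F]_(e, d)) f' (g : 'M_(d, c)) g' :
  biprod f f' g g' -> row_full g.
Proof. by case=> _ h _ _ _; apply/row_fullP; exists g'. Qed.

Lemma biprod_factorl e d c (f : 'M[F]_(e, d)) f' (g : 'M_(d, c)) g' m
    (u : 'M_(m, d)) :
  biprod f f' g g' -> u *m g = 0 -> u = u *m f' *m f.
Proof.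
case=> _ _ _ _ h5 ug; rewrite -[LHS]mulmx1 -h5 mulmxDr !mulmxA ug mul0mx.
by rewrite addr0.
Qed.

Lemma biprod_factorr e d c (f : 'M[F]_(e, d)) f' (g : 'M_(d, c)) g' m
    (u : 'M_(d, m)) :
  biprod f f' g g' -> f *m u = 0 -> u = g *m (g' *m u).
Proof.
case=> _ _ _ _ h5 fu; rewrite -[LHS]mul1mx -h5 mulmxDl -!mulmxA fu mulmx0.
by rewrite add0r.
Qed.

Lemma biprod_ker e d c (f : 'M[F]_(e, d)) f' (g : 'M_(d, c)) g' :
  biprod f f' g g' -> (f == kermx g)%MS.
Proof.
move=> bp; have [h1 h2 h3 h4 h5] := bp; apply/andP; split.
  by apply/sub_kermxP.
rewrite (biprod_factorl bp (mulmx_ker g)); exact: submxMl.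
Qed.

Lemma biprod_of_exact e d c (f : 'M[F]_(e, d)) (g : 'M_(d, c)) :
  row_free f -> (f == kermx g)%MS -> row_full g ->
    exists f' g', biprod f f' g g'.
Proof.
move=> ff /andP[fk kf] gf; have fg : f *m g = 0 by apply/sub_kermxP.
have [g' g'g] := row_fullP gf.
have : (1%:M - g *m g' <= f)%MS.
  apply: submx_trans kf; apply/sub_kermxP.
  by rewrite mulmxBl mul1mx -mulmxA g'g mulmx1 subrr.
case/submxP=> f' ef'; exists f', g'; split=> //.
- apply: (row_free_inj ff);
    rewrite -mulmxA -ef' mulmxBr mulmx1 mulmxA fg mul0mx.
  by rewrite subr0 mul1mx.
- apply: (row_free_inj ff);
    rewrite -mulmxA -ef' mulmxBr mulmx1 mulmxA g'g mul1mx.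
  by rewrite subrr mul0mx.
by rewrite -ef' subrK.
Qed.

Lemma biprod_dim e d c (f : 'M[F]_(e, d)) f' (g : 'M_(d, c)) g' :
  biprod f f' g g' -> d = (e + c)%N.
Proof.
move=> bp; have := eqmx_rank (biprod_ker bp).
have /eqP -> := biprod_row_free bp.
have /eqP rg := biprod_row_full bp; rewrite mxrank_ker rg => ->.
by rewrite subnK // -rg rank_leq_row.
Qed.

Lemma biprod_of_free e d c (f : 'M[F]_(e, d)) :
  row_free f -> d = (e + c)%N -> exists f' g g', @biprod e d c f f' g g'.
Proof.
move=> ff ed; subst d.
have rC : \rank (f^C)%MS = c.
  by rewrite mxrank_compl; have /eqP -> := ff; rewrite addKn.
pose g' : 'M_(c, e + c) := castmx (rC, erefl) (row_base (f^C)%MS).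
have g'C : (g' :=: f^C)%MS.
  by rewrite /g'; apply: eqmx_trans (eqmx_cast _ _) (eq_row_base _).
have uA : col_mx f g' \in unitmx.
  rewrite -row_full_unit -sub1mx -addsmxE (adds_eqmx (eqmx_refl f) g'C).
  by rewrite sub1mx addsmx_compl_full.
pose B := invmx (col_mx f g').
have AB : col_mx f g' *m row_mx (lsubmx B) (rsubmx B) = 1%:M.
  by rewrite hsubmxK mulmxV.
have BA : row_mx (lsubmx B) (rsubmx B) *m col_mx f g' = 1%:M.
  by rewrite hsubmxK mulVmx.
move: AB; rewrite mul_col_row (scalar_mx_block e c 1) =>
  /eq_block_mx[h1 h2 h3 h4].
by exists (lsubmx B), (rsubmx B), g'; split=> //; rewrite -mul_row_col.
Qed.

Lemma biprod_exists e c : exists f f' g g', @biprod e (e + c) c f f' g g'.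
Proof.
have ff : row_free (row_mx 1%:M 0 : 'M[F]_(e, e + c)).
  apply/row_freeP; exists (col_mx 1%:M 0).
  by rewrite mul_row_col mulmx1 mulmx0 addr0.
by have [f' [g [g' bp]]] := biprod_of_free ff erefl;
  exists (row_mx 1%:M 0), f', g, g'.
Qed.

Lemma biprod_of_full d c e (g : 'M[F]_(d, c)) :
  row_full g -> d = (e + c)%N -> exists f f' g', @biprod e d c f f' g g'.
Proof.
move=> gf ed.
have rk : \rank (kermx g) = e.
  by rewrite mxrank_ker; have /eqP -> := gf; rewrite ed addnK.
pose f : 'M_(e, d) := castmx (rk, erefl) (row_base (kermx g)).
have fk : (f :=: kermx g)%MS.
  by rewrite /f; apply: eqmx_trans (eqmx_cast _ _) (eq_row_base _).
have ff : row_free f by rewrite /row_free fk rk.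
have fk' : (f == kermx g)%MS by apply/eqmxP.
have [f' [g' bp]] := biprod_of_exact ff fk' gf.
by exists f, f', g'.
Qed.

Lemma row_base_factor d m (r : nat) (A : 'M[F]_(d, m)) : \rank A = r ->
  exists (C : 'M_(d, r)) (B : 'M_(r, m)),
    [/\ A = C *m B, row_full C & row_free B].
Proof.
move=> rA; subst r; exists (col_base A), (row_base A).
by rewrite mulmx_base row_base_free col_base_full.
Qed.

End Biproducts.

(** * Matrices depending polynomially on a parameter *)
Local Notation ev s A := (map_mx (horner_eval s) A).
Local Notation cf k A := (map_mx (coefp k) A).
Local Notation cst A := (map_mx polyC A).

Section GenericRank.
Variable K : fieldType.

Lemma rank_pivots m n (A : 'M[K]_(m, n)) :
  exists (L : 'M_(\rank A, m)) (R : 'M_(n, \rank A)), L *m A *m R = 1%:M.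
Proof.
exists (pinvmx (col_base A)), (pinvmx (row_base A)).
have -> : pinvmx (col_base A) *m A = row_base A.
  transitivity (pinvmx (col_base A) *m (col_base A *m row_base A)).
    by rewrite mulmx_base.
  by rewrite mulmxA mulVpmx ?col_base_full // mul1mx.
by rewrite mulmxVp ?row_base_free.
Qed.

(** Ranks are lower semicontinuous: compress A to an r x r block that is the
    identity at s0; its determinant is the required polynomial. *)
Lemma rank_generic m n (A : 'M[{poly K}]_(m, n)) s0 :
  exists2 p : {poly K}, p.[s0] != 0 &
    forall s, p.[s] != 0 -> (\rank (ev s0 A) <= \rank (ev s A))%N.
Proof.
have [L [R LAR]] := rank_pivots (ev s0 A).
pose B := map_mx polyC L *m A *m map_mx polyC R.
have evB s : ev s B = L *m ev s A *m R.
  rewrite !map_mxM; congr (_ *m _ *m _); apply/matrixP=> i j;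
  by rewrite !mxE /= /horner_eval ?hornerC.
have evp s : (\det B).[s] = \det (L *m ev s A *m R).
  by rewrite -evB det_map_mx.
exists (\det B); first by rewrite evp LAR det1 oner_eq0.
move=> s; rewrite evp => ps.
have: L *m ev s A *m R \in unitmx by rewrite unitmxE unitfE.
rewrite -row_free_unit => /eqP <-.
exact: leq_trans (mxrankM_maxl _ _) (mxrankM_maxr _ _).
Qed.

(** The Schur complement of an invertible r x r compression vanishes when M has
    rank r.  So I - M R (L M R)^-1 L maps every row vector into the kernel of
    M. *)
Lemma rank_cur m n r (M : 'M[K]_(m, n)) (L : 'M_(r, m)) (R : 'M_(n, r)) :
  (\rank M <= r)%N -> L *m M *m R \in unitmx ->
  M *m R *m invmx (L *m M *m R) *m L *m M = M.
Proof.
move=> rM u.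
have rLM : \rank (L *m M) = \rank M.
  apply/eqP; rewrite eqn_leq mxrankM_maxr (leq_trans rM) //.
  move: u; rewrite -row_free_unit => /eqP {1}<-; exact: mxrankM_maxl.
have /submxP[D eD] : (M <= L *m M)%MS.
  by rewrite -(geq_leqif (mxrank_leqif_sup (submxMl L M))) rLM.
have eR : M *m R = D *m (L *m M *m R) by rewrite mulmxA -eD.
by rewrite eR -(mulmxA D) (mulmxV u) mulmx1 -mulmxA -eD.
Qed.
End GenericRank.

Section Pencils.
Variable K : closedFieldType.

Lemma poly_eq0_generic (p q : {poly K}) :
  p != 0 -> (forall s, p.[s] != 0 -> q.[s] = 0) -> q = 0.
Proof.
move=> p0 pq; apply/eqP/negPn/negP => q0.
have : p * q != 0 by rewrite mulf_neq0.
case/closed_nonrootP=> s; rewrite /root hornerM mulf_eq0 negb_or => /andP[ps].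
by rewrite (pq s ps) eqxx.
Qed.

Lemma generic_point (p q : {poly K}) : p != 0 -> q != 0 ->
  exists s, p.[s] != 0 /\ q.[s] != 0.
Proof.
move=> p0 q0; have : p * q != 0 by rewrite mulf_neq0.
case/closed_nonrootP=> s; rewrite /root hornerM mulf_eq0 negb_or => /andP[].
by exists s.
Qed.

Lemma ev_cst s m n (A : 'M[K]_(m, n)) : ev s (cst A) = A.
Proof. by apply/matrixP=> i j; rewrite !mxE /= /horner_eval hornerC. Qed.

Lemma ev0_cf m n (A : 'M[{poly K}]_(m, n)) : ev 0 A = cf 0 A.
Proof. by apply/matrixP=> i j; rewrite !mxE /= /horner_eval horner_coef0. Qed.

(** When the rank at 0 is the generic one, kernel vectors at 0 extend to
    polynomial families of kernel vectors: apply the projector of [rank_cur],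
    whose only denominator is the determinant of the compression, and clear
    it. *)
Lemma kernel_lift m n (M : 'M[{poly K}]_(m, n)) (p : {poly K}) (f : 'rV_m) :
  p != 0 -> (forall s, p.[s] != 0 -> (\rank (ev s M) <= \rank (ev 0%R M))%N) ->
  f *m ev 0 M = 0 -> exists2 G : 'rV_m, ev 0 G = f & G *m M = 0.
Proof.
move=> p0 rM fM; have [L [R LR]] := rank_pivots (ev 0 M).
pose U := cst L *m M *m cst R.
have evU s : ev s U = L *m ev s M *m R by rewrite !map_mxM !ev_cst.
have evd s : (\det U).[s] = \det (L *m ev s M *m R) by rewrite -evU det_map_mx.
exists (\det U *: cst f - cst f *m M *m cst R *m \adj U *m cst L).
  rewrite map_mxB map_mxZ !map_mxM !ev_cst fM !mul0mx subr0 /=.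
  by rewrite /horner_eval evd LR det1 scale1r.
have pU : p * \det U != 0.
  rewrite mulf_neq0 //; apply/closed_nonrootP; exists 0.
  by rewrite /root evd LR det1 oner_eq0.
apply/rowP=> j; rewrite [RHS]mxE; apply: (poly_eq0_generic pU) => s.
rewrite hornerM mulf_eq0 negb_or => /andP[/rM rs ds].
suff /rowP/(_ j) : ev s
  ((\det U *: cst f - cst f *m M *m cst R *m \adj U *m cst L) *m M) = 0.
  by rewrite !mxE.
have dU : horner_eval s (\det U) = (\det U).[s] by [].
rewrite map_mxM map_mxB map_mxZ !map_mxM /= !ev_cst dU map_mx_adj evU evd in ds
  *.
set V := L *m ev s M *m R in ds *.
have uV : V \in unitmx by rewrite unitmxE unitfE.
rewrite mulmxBl -scalemxAl.
have -> : \adj V = \det V *: invmx V.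
  by rewrite /invmx uV scalerA mulfV // scale1r.
rewrite -!(scalemxAr, scalemxAl) -scalerBr -!mulmxA.
by rewrite [X in _ *: (_ - _ *m X)]mulmxA [X in _ *: (_ - _ *m X)]mulmxA
  [X in _ *: (_ - _ *m X)]mulmxA rank_cur // subrr scaler0.
Qed.

Lemma cfM1 m n q (A : 'M[{poly K}]_(m, n)) (B : 'M_(n, q)) :
  cf 1 (A *m B) = cf 0 A *m cf 1 B + cf 1 A *m cf 0 B.
Proof.
apply/matrixP=> i j; rewrite !mxE /= coef_sum -big_split; apply: eq_bigr => k _.
by rewrite coefM big_ord_recl big_ord1 /= !mxE.
Qed.

(** A tangent vector to the matrices of rank at most r, at a point of rank r,
    maps the kernel into the image.  Differentiate a family of kernel vectors at
    0. *)
Lemma rank_tangent m n (M : 'M[{poly K}]_(m, n)) (p : {poly K}) :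
  p != 0 -> (forall s, p.[s] != 0 -> (\rank (ev s M) <= \rank (ev 0%R M))%N) ->
  (kermx (cf 0 M) *m cf 1 M <= cf 0 M)%MS.
Proof.
move=> p0 rM; apply/row_subP=> i; rewrite row_mul.
have k0 : row i (kermx (cf 0 M)) *m cf 0 M = 0.
  by rewrite -row_mul mulmx_ker row0.
have [|G G0 GM] := kernel_lift p0 rM (f := row i (kermx (cf 0 M))).
  by rewrite ev0_cf.
have := cfM1 G M; rewrite GM -ev0_cf G0 map_mx0 => /esym/eqP.
by rewrite addr_eq0 => /eqP ->; rewrite -mulNmx submxMl.
Qed.

End Pencils.

(** * Pencils of linear maps *)
Section LinearPencils.
Import VectorInternalTheory.
Variable K : closedFieldType.
Variables V W : vectType K.
Implicit Types D : 'Hom(V, W).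

Lemma v2r_lfun D v : v2r (D v) = v2r v *m f2mx D.
Proof. by rewrite unlock /= r2vK. Qed.

Lemma f2mx_pencil D0 D1 (s : K) : f2mx (D0 + s *: D1) = f2mx D0 + s *: f2mx D1.
Proof.
apply/row_matrixP => i; rewrite !rowE mulmxDr -scalemxAr.
rewrite -[delta_mx 0 i](@r2vK K V) -!v2r_lfun -linearZ -linearD.
by rewrite add_lfunE scale_lfunE.
Qed.

Lemma dim_lker D : (\dim (lker D) = dim V - \rank (f2mx D))%N.
Proof. by rewrite /dimv mx2vsK mxrank_ker. Qed.

Definition pencil_mx D0 D1 : 'M[{poly K}]_(dim V, dim W) :=
  cst (f2mx D0) + 'X *: cst (f2mx D1).

Lemma ev_pencil D0 D1 s : ev s (pencil_mx D0 D1) = f2mx (D0 + s *: D1).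
Proof.
by rewrite f2mx_pencil map_mxD map_mxZ !ev_cst /= /horner_eval hornerX.
Qed.

Lemma ker_pencil_generic D0 D1 s0 : exists2 p : {poly K}, p.[s0] != 0 &
  forall s, p.[s] != 0 ->
    (\dim (lker (D0 + s *: D1)%R) <= \dim (lker (D0 + s0 *: D1)%R))%N.
Proof.
have [p p0 rp] := rank_generic (pencil_mx D0 D1) s0; exists p => // s /rp.
by rewrite !ev_pencil !dim_lker; apply: leq_sub2l.
Qed.

(** The relation between g 1 and f is the coefficient of s in the membership
    below; it is singled out because first-order deformations need no more.  The
    sum has at least two terms so that g 1 is its derivative at 0. *)
Lemma ker_pencil_lift D0 D1 (p : {poly K}) (f : V) :
  p != 0 ->
  (forall s, p.[s] != 0 ->
    (\dim (lker D0) <= \dim (lker (D0 + s *: D1)%R))%N) ->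
  f \in lker D0 ->
  exists (n : nat) (g : nat -> V), [/\ g 0 = f, D0 (g 1%N) + D1 f = 0 &
    forall s, \sum_(k < n.+2) s ^+ k *: g k \in lker (D0 + s *: D1)].
Proof.
move=> p0 dk; rewrite memv_ker => /eqP D0f.
have rk s : p.[s] != 0 ->
    (\rank (ev s (pencil_mx D0 D1)) <= \rank (ev 0%R (pencil_mx D0 D1)))%N.
  move=> /dk; rewrite !ev_pencil scale0r addr0 !dim_lker leq_sub2lE //.
  exact: rank_leq_row.
have [|G G0 GM] := kernel_lift p0 rk (f := v2r f).
  by rewrite ev_pencil scale0r addr0 -v2r_lfun D0f linear0.
pose g k := r2v (map_mx (coefp k) G).
pose n := \max_j size (G 0%R j).
have sG s : \sum_(k < n.+2) s ^+ k *: g k = r2v (ev s G).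
  rewrite /g -[LHS](@v2rK K V) linear_sum; congr r2v.
  apply/rowP=> j; rewrite summxE !mxE /= /horner_eval.
  rewrite (@horner_coef_wide _ n.+2); last first.
    by apply: leq_trans (leqnSn _); apply: leq_trans (leqnSn _);
      rewrite /n leq_bigmax.
  by apply: eq_bigr => k _; rewrite linearZ /= r2vK !mxE mulrC.
exists n, g; split.
- by rewrite /g -ev0_cf G0 v2rK.
- apply: (can_inj (@v2rK K W)); rewrite [LHS]linearD [RHS]linear0 /=;
    rewrite !v2r_lfun /g r2vK.
  have := cfM1 G (pencil_mx D0 D1); rewrite GM map_mx0 -!ev0_cf G0 ev_pencil.
  rewrite scale0r addr0 => ->; rewrite addrC; congr (_ *m _ + _).
  apply/matrixP=> i j; rewrite !mxE /= coefD coefC coefXM coefC /=.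
  by rewrite add0r.
move=> s; rewrite memv_ker sG; apply/eqP/(can_inj (@v2rK K W)).
by rewrite v2r_lfun r2vK -ev_pencil -map_mxM GM map_mx0 linear0.
Qed.

End LinearPencils.

(** * Places with values in an algebraically closed field *)
Section Places.
Variables (K : closedFieldType) (L : fieldType).
Local Open Scope classical_set_scope.

(** The graph of a ring morphism from a subring of L onto K, so that extensions
    are inclusions and Zorn's lemma applies directly. *)
Definition partial_hom (G : set (L * K)) : Prop :=
  [/\ G (1, 1), forall u v, G u -> G v -> G (u - v),
      forall u v, G u -> G v -> G (u * v), forall c, exists x, G (x, c)
    & forall c, G (0, c) -> c = 0].

Section Closure.
Variable G : set (L * K).
Hypothesis hG : partial_hom G.

Let G1 : G (1, 1). Proof. by case: hG. Qed.
Let GB u v : G u -> G v -> G (u - v). Proof. by case: hG => _ + _ _ _;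
  apply. Qed.
Lemma partial_homM u v : G u -> G v -> G (u * v).
Proof. by case: hG => _ _ + _ _; apply. Qed.
Let GK c : exists x, G (x, c). Proof. by case: hG => _ _ _ + _; apply. Qed.
Let Gf c : G (0, c) -> c = 0. Proof. by case: hG => _ _ _ _ +; apply. Qed.

Lemma partial_hom0 : G 0.
Proof. by rewrite -(subrr (1 : L * K)); apply: GB. Qed.

Lemma partial_homD u v : G u -> G v -> G (u + v).
Proof.
move=> Gu Gv; rewrite -[v]opprK; apply: GB => //.
by rewrite -sub0r; apply: GB => //; apply: partial_hom0.
Qed.

Lemma partial_hom_sum (I : finType) (u : I -> L * K) :
  (forall i, G (u i)) -> G (\sum_i u i).
Proof. by move=> Gu; elim/big_ind: _ => //;
  [exact: partial_hom0 | exact: partial_homD]. Qed.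

Lemma partial_homX u n : G u -> G (u ^+ n).
Proof. by move=> Gu; elim: n => [|n IH]; rewrite ?expr0 // exprS;
  apply: partial_homM. Qed.

Lemma partial_hom_fun x c c' : G (x, c) -> G (x, c') -> c = c'.
Proof.
move=> h h'; have := GB h h'; rewrite /= => h''; apply/eqP; rewrite -subr_eq0.
by apply/eqP/Gf; move: h''; rewrite -[_ - _]/(x - x, c - c') subrr.
Qed.

End Closure.

Lemma expf_subn (F : fieldType) (x : F) k i :
  x != 0 -> (i <= k)%N -> x ^+ (k - i) = x ^+ k * x^-1 ^+ i.
Proof. by move=> x0 ik; rewrite exprVn expfB_cond // (negPf x0). Qed.

Lemma pairE_sum (I : finType) (x : I -> L) (c : I -> K) :
  \sum_i (x i, c i) = (\sum_i x i, \sum_i c i) :> L * K.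
Proof. by elim/big_rec3: _ => // i y1 y2 y3 _ ->. Qed.

Lemma pairE_exp (x : L) (c : K) n : (x, c) ^+ n = (x ^+ n, c ^+ n).
Proof. by elim: n => // n IH; rewrite !exprS IH. Qed.

Section Maximal.
Variable G : set (L * K).
Hypothesis hG : partial_hom G.
Hypothesis maxG : forall B, partial_hom B -> G `<=` B -> B `<=` G.

Definition poly_graph (P : {poly L}) (Q : {poly K}) := forall i, G (P`_i, Q`_i).

Lemma poly_graphB P Q P' Q' :
  poly_graph P Q -> poly_graph P' Q' -> poly_graph (P - P') (Q - Q').
Proof.
case: hG => _ GB _ _ _ h h' i; rewrite !coefB.
exact: (GB _ _ (h i) (h' i)).
Qed.

Lemma poly_graphM P Q P' Q' :
  poly_graph P Q -> poly_graph P' Q' -> poly_graph (P * P') (Q * Q').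
Proof.
move=> h h' i; rewrite !coefM -pairE_sum.
apply: partial_hom_sum => // k.
exact: (partial_homM hG (h k) (h' _)).
Qed.

Lemma poly_graphC x c : G (x, c) -> poly_graph x%:P c%:P.
Proof. by move=> h i; rewrite !coefC; case: eqP => // _;
  apply: partial_hom0. Qed.

Lemma poly_graphX : poly_graph 'X 'X.
Proof.
move=> i; rewrite !coefX; case: eqP => _; first by case: hG.
exact: partial_hom0.
Qed.

(** By maximality, x lies in the domain with value c as soon as evaluation at
    (x, c) is well defined on polynomials. *)
Lemma adjoin_value x c :
  (forall P Q, poly_graph P Q -> P.[x] = 0 -> Q.[c] = 0) -> G (x, c).
Proof.
move=> h.
pose B : set (L * K) :=
  [set u | exists P Q, poly_graph P Q /\ u = (P.[x], Q.[c])].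
have GB : G `<=` B.
  move=> [y d] Gy; exists y%:P, d%:P; rewrite !hornerC; split=> //.
  exact: poly_graphC.
apply: (maxG _ GB); last by exists 'X, 'X; rewrite !hornerX; split=> //;
  apply: poly_graphX.
split.
- by apply: GB; case: hG.
- move=> _ _ [P [Q [h1 ->]]] [P' [Q' [h1' ->]]]; exists (P - P'), (Q - Q').
  by rewrite !hornerD !hornerN; split=> //; apply: poly_graphB.
- move=> _ _ [P [Q [h1 ->]]] [P' [Q' [h1' ->]]]; exists (P * P'), (Q * Q').
  by rewrite !hornerM; split=> //; apply: poly_graphM.
- by move=> d; case: hG => _ _ _ /(_ d)[y Gy] _; exists y; apply: GB.
by move=> d [P [Q [h1 [/esym e ->]]]]; apply: h h1 e.
Qed.

(** With m the kernel of the morphism, P has constant coefficient in 1 + m and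
    the other coefficients in m: x is a root of a polynomial that is sent to 1
    and has degree at most n. *)
Definition unit_root x n :=
  exists P, [/\ poly_graph P 1, P.[x] = 0 & (size P <= n.+1)%N].

(** The polynomials over K whose lifts vanish at x form an ideal.  If they have
    a common root, it can be taken as the value of x; otherwise the ideal
    contains 1, because K is algebraically closed. *)
Lemma value_or_unit_root x : (exists c, G (x, c)) \/ exists n, unit_root x n.
Proof.
have [[c hc]|nc] :=
  pselect (exists c, forall P Q, poly_graph P Q -> P.[x] = 0 -> Q.[c] = 0).
  by left; exists c; apply: adjoin_value.
right; pose J n := `[< exists P Q, [/\ poly_graph P Q, P.[x]
  = 0, Q != 0 & size Q = n] >].
have exJ : exists n, J n.
  apply: contrapT => nJ; apply: nc; exists 0 => P Q h Px.
  have [->|Q0] := eqVneq Q 0; first by rewrite horner0.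
  by case: nJ; exists (size Q); apply/asboolP; exists P, Q.
case: (ex_minnP exJ) => n /asboolP[P [Q [h Px Q0 sQ]]] minn.
have dvdQ P' Q' : poly_graph P' Q' -> P'.[x] = 0 -> Q %| Q'.
  move=> h' P'x; rewrite /dvdp; apply: contraT => r0.
  have hq : exists R, poly_graph R (Q' %/ Q).
    have [y hy] := (choice (let: And5 _ _ _ h _ := hG in h)).
    exists (\poly_(i < size (Q' %/ Q)%R) y (Q' %/ Q)`_i) => i.
    rewrite coef_poly; case: ltnP => [_ // | /(nth_default 0) ->].
    exact: partial_hom0.
  have [R hR] := hq.
  have: (n <= size (Q' %% Q)%R)%N.
    apply: minn; apply/asboolP; exists (P' - R * P), (Q' %% Q); split=> //.
      rewrite (_ : Q' %% Q = Q' - (Q' %/ Q) * Q).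
        by apply: poly_graphB => //; apply: poly_graphM.
      by apply/eqP; rewrite eq_sym subr_eq addrC -divp_eq.
    by rewrite hornerD hornerN hornerM P'x Px mulr0 subrr.
  by rewrite leqNgt -sQ ltn_modp Q0.
have [[c Qc]|] := altP (closed_rootP Q).
  case: nc; exists c => P' Q' h' P'x;
    rewrite -(divpK (dvdQ _ _ h' P'x)) hornerM.
  by rewrite (rootP Qc) mulr0.
move/negPn/size_poly1P=> [q q0 eQ].
have [y Gy] : exists y, G (y, q^-1) by case: hG => _ _ _ + _; apply.
exists (size P), (y%:P * P); split=> //.
- rewrite (_ : 1 = q^-1%:P * Q); first by apply: poly_graphM => //;
    apply: poly_graphC.
  by rewrite eQ -polyCM mulVf.
- by rewrite hornerM Px mulr0.
by rewrite mul_polyC (leq_trans (size_scale_leq _ _)).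
Qed.

Lemma value_inv a b : G (a, b) -> b != 0 -> G (a^-1, b^-1).
Proof.
move=> Gab b0.
have a0 : a != 0.
  by apply: contraNneq b0 => a0; case: hG => _ _ _ _ + ; rewrite a0 in Gab;
    move/(_ _ Gab) ->.
apply: adjoin_value => P Q h Pa.
pose n := maxn (size P) (size Q).
have E (F : fieldType) (S : {poly F}) (z : F) : z != 0 -> (size S <= n)%N ->
    \sum_(i < n) S`_i * z ^+ (n - i) = z ^+ n * S.[z^-1].
  move=> z0 sS; rewrite (horner_coef_wide _ sS) mulr_sumr; apply: eq_bigr =>
    i _.
  by rewrite (expf_subn z0 (ltnW (ltn_ord i))) mulrCA.
have : G (\sum_(i < n) P`_i * a ^+ (n - i), \sum_(i < n) Q`_i * b ^+ (n - i)).
  rewrite -pairE_sum; apply: partial_hom_sum => // i.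
  have Gk : G (a ^+ (n - i), b ^+ (n - i)) by rewrite -pairE_exp;
    apply: partial_homX.
  exact: (partial_homM hG (h i) Gk).
rewrite !E ?leq_maxl ?leq_maxr // Pa mulr0 => G0.
case: hG => _ _ _ _ /(_ _ G0) /eqP.
by rewrite mulf_eq0 expf_eq0 (negPf b0) andbF => /eqP.
Qed.

(** Chevalley's argument: if x and its inverse are roots of such polynomials,
    the equation of lower degree, divided by its invertible constant
    coefficient, eliminates the leading term of the other one. *)
Lemma not_unit_root_inv N x n m :
  (n + m <= N)%N -> x != 0 -> unit_root x n -> unit_root x^-1 m -> False.
Proof.
elim: N x n m => [|N IH] x n m.
  rewrite leqn0 addn_eq0 => /andP[/eqP -> _] _ [P [h Px sP]] _.
  have P0 : P`_0 = 0 by move: Px; rewrite {1}(size1_polyC sP) hornerC.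
  have G01 := h 0%N; rewrite coef1 P0 /= in G01.
  by case: hG => _ _ _ _ /(_ _ G01) /eqP; rewrite oner_eq0.
wlog mn : x n m / (m <= n)%N.
  move=> W; have [mn|/ltnW nm] := leqP m n; first exact: W.
  rewrite addnC => lN x0 Wx Wx'; apply: (W x^-1 m n) => //;
    first by rewrite invr_eq0.
  by rewrite invrK.
case: n mn => [|n] mn lN x0.
  move=> Wx Wx'; apply: (IH x 0%N m) => //.
  by move: mn; rewrite leqn0 => /eqP ->.
move=> [P [h Px sP]] [R [h' Rx sR]].
have v1 : G (R`_0, 1) by have := h' 0%N; rewrite coef1.
have v0 : R`_0 != 0.
  apply: contra_notN (_ : (1 : K) <> 0) => [/eqP v0|/eqP];
    last by rewrite oner_eq0.
  by rewrite v0 in v1; case: hG => _ _ _ _ /(_ _ v1).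
have Gv : G ((R`_0)^-1, 1) by rewrite -[X in (_, X)]invr1; apply: value_inv =>
  //; rewrite oner_eq0.
(* The polynomial reciprocal to R, made monic, of degree n + 1. *)
pose R' := \poly_(i < n.+2) ((R`_0)^-1 * R`_(n.+1 - i)).
have R'x : R'.[x] = 0.
  rewrite horner_poly (reindex_inj rev_ord_inj) /=.
  transitivity ((R`_0)^-1 * x ^+ n.+1 * R.[x^-1]); last by rewrite Rx mulr0.
  rewrite (@horner_coef_wide _ n.+2) ?(leq_trans sR) // mulr_sumr.
  apply: eq_bigr => i _; have li : (i <= n.+1)%N by rewrite -ltnS.
  rewrite subSS (subKn li) (expf_subn x0 li) -!mulrA; congr (_ * _).
  by rewrite mulrCA.
have GPn : G (P`_n.+1, 0) by have := h n.+1; rewrite coef1.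
apply: (IH x n m) => //; last by exists R.
exists (P - P`_n.+1 *: R'); split.
- move=> i; rewrite coefB coefZ coef_poly.
  have hi := h i; case: ltnP => li; last by rewrite mulr0 subr0.
  have G2 := partial_homM hG GPn (partial_homM hG Gv (h' (n.+1 - i)%N)).
  case: hG => _ GB _ _ _; have := GB _ _ hi G2.
  by rewrite -[_ - _]/(_ - _, _ - _) /= mul0r subr0.
- by rewrite hornerD hornerN hornerZ R'x mulr0 subr0.
apply/leq_sizeP => j; rewrite leq_eqVlt => /predU1P[<-|lj].
  by rewrite coefB coefZ coef_poly ltnSn subnn mulVf // mulr1 subrr.
rewrite coefB coefZ coef_poly ltnNge lj mulr0 subr0.
by rewrite nth_default // (leq_trans sP).
Qed.

Lemma maximal_place x : (exists c, G (x, c)) \/ G (x^-1, 0).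
Proof.
have [->|x0] := eqVneq x 0; first by left; exists 0; apply: partial_hom0.
have [|[n Wx]] := value_or_unit_root x; first by left.
have [[c Gc]|[m Wx']] := value_or_unit_root x^-1; last first.
  by case: (not_unit_root_inv (leqnn _) x0 Wx Wx').
have [c0|c0] := eqVneq c 0; first by right; rewrite -c0.
by left; exists c^-1; rewrite -[x]invrK; apply: value_inv.
Qed.

End Maximal.

(** A maximal extension is defined on a valuation ring of L.  Prescribing that
    the values lie in K, instead of passing to a residue field, avoids the
    Nullstellensatz. *)
Lemma place_extension S : partial_hom S -> exists G, [/\ S `<=` G, partial_hom G
  & forall x, (exists c, G (x, c)) \/ G (x^-1, 0)].
Proof.
move=> hS; pose P (A : set (L * K)) := A !=set0 -> S `<=` A /\ partial_hom A.
have S0 : S !=set0 by exists (1, 1); case: hS.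
have [|G [PG maxG]] := @Zorn_bigcup _ P.
  move=> F FP totF [u0 [X0 FX0 X0u0]].
  have FG X u : F X -> X u -> S `<=` X /\ partial_hom X by move=> FX Xu;
    apply: FP => //; exists u.
  have [SX0 [X1 _ _ XK _]] := FG _ _ FX0 X0u0.
  have two u v : (\bigcup_(X in F) X) u -> (\bigcup_(X in F) X) v ->
      exists X, [/\ F X, partial_hom X, X u & X v].
    move=> [X FX Xu] [Y FY Yv]; have [XY|YX] := totF _ _ FX FY.
      by exists Y; split=> //; [have [] := FG _ _ FY Yv | apply: XY].
    by exists X; split=> //; [have [] := FG _ _ FX Xu | apply: YX].
  split; first by move=> u Su; exists X0 => //; apply: SX0.
  split.
  - by exists X0.
  - move=> u v /two h /h [X [FX [_ XB _ _ _] Xu Xv]]; exists X => //; exact: XB.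
  - move=> u v /two h /h [X [FX [_ _ XM _ _] Xu Xv]]; exists X => //; exact: XM.
  - by move=> c; have [x Xx] := XK c; exists x; exists X0.
  by move=> c [X FX X0c]; have [_ [_ _ _ _ +]] := FG _ _ FX X0c; apply.
have PS : P S by move=> _; split.
have G0 : G !=set0.
  apply: contrapT => /nonemptyPn G0; apply: (maxG S) PS; rewrite G0; split.
    by move=> u [].
  by move=> h; have [u /h] := S0.
have [SG hG] := PG G0; exists G; split=> //; apply: maximal_place => //.
move=> B hB GB; apply: contrapT => nBG; apply: (maxG B); first by split.
by move=> _; split=> //; apply: subset_trans GB.
Qed.

End Places.

(** * Formal power series *)
Section PowerSeries.
Variable K : fieldType.

Definition pser : Type := nat -> K.
HB.instance Definition _ := gen_eqMixin pser.
HB.instance Definition _ := gen_choiceMixin pser.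

(** Ring identities are checked on truncations, where they hold in the ring of
    polynomials. *)
Definition trunc n (f : pser) : {poly K} := \poly_(i < n.+1) f i.

Lemma coef_trunc n f i : (i <= n)%N -> (trunc n f)`_i = f i.
Proof. by move=> h; rewrite coef_poly ltnS h. Qed.

Definition pser_mul (f g : pser) : pser :=
  fun n => \sum_(k < n.+1) f k * g (n - k)%N.

Lemma pser_mulE m n f g : (n <= m)%N ->
  pser_mul f g n = (trunc m f * trunc m g)`_n.
Proof.
move=> nm; rewrite coefM; apply: eq_bigr => k _.
by rewrite !coef_trunc // ?(leq_trans (leq_subr _ _)) // (leq_trans _ nm) //
  -ltnS.
Qed.

Definition pser_const (c : K) : pser := fun n => if n is 0 then c else 0.

Fact pser_addA : associative (fun f g : pser => (fun n => f n + g n) : pser).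
Proof. by move=> f g h; apply/funext=> n; rewrite addrA. Qed.
Fact pser_addC : commutative (fun f g : pser => (fun n => f n + g n) : pser).
Proof. by move=> f g; apply/funext=> n; rewrite addrC. Qed.
Fact pser_add0 :
  left_id ((fun _ => 0) : pser) (fun f g : pser => (fun n => f n + g n) : pser).
Proof. by move=> f; apply/funext=> n; rewrite add0r. Qed.
Fact pser_addN : left_inverse ((fun _ => 0) : pser)
  (fun f : pser => (fun n => - f n) : pser) (fun f g
    : pser => (fun n => f n + g n) : pser).
Proof. by move=> f; apply/funext=> n; rewrite addNr. Qed.

HB.instance Definition _ :=
  GRing.isZmodule.Build pser pser_addA pser_addC pser_add0 pser_addN.

Lemma pserD (f g : pser) n : (f + g) n = f n + g n. Proof. by []. Qed.
Lemma pser0 n : (0 : pser) n = 0. Proof. by []. Qed.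
Lemma pser_sum I (r : seq I) P (F : I -> pser) n :
  (\sum_(i <- r | P i) F i) n = \sum_(i <- r | P i) F i n.
Proof. by elim/big_rec2: _ => // i y1 y2 _ <-. Qed.

Lemma pser_eq (f g : pser) : f =1 g -> f = g.
Proof. by move=> h; apply/funext. Qed.

Fact pser_mulA : associative pser_mul.
Proof.
move=> f g h; apply: pser_eq => n;
  rewrite -[LHS]/(\sum_(k < n.+1) _) -[RHS]/(\sum_(k < n.+1) _).
transitivity ((trunc n f * (trunc n g * trunc n h))`_n).
  rewrite coefM; apply: eq_bigr => k _; rewrite coef_trunc -1?ltnS //.
  by rewrite (pser_mulE (m := n)) // leq_subr.
rewrite mulrA coefM; apply: eq_bigr => k _.
by rewrite coef_trunc ?leq_subr // (pser_mulE (m := n)) // -ltnS.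
Qed.

Fact pser_mulC : commutative pser_mul.
Proof. by move=> f g; apply: pser_eq => n;
  rewrite !(pser_mulE (m := n)) // mulrC. Qed.

Fact pser_mul1 : left_id (pser_const 1) pser_mul.
Proof.
move=> f; apply: pser_eq => n; rewrite /pser_mul big_ord_recl /= mul1r subn0.
by rewrite big1 ?addr0 // => i _; rewrite mul0r.
Qed.

Fact pser_mulD : left_distributive pser_mul +%R.
Proof.
move=> f g h; apply: pser_eq => n; rewrite pserD -big_split.
by apply: eq_bigr => k _; rewrite pserD mulrDl.
Qed.

Fact pser_1neq0 : pser_const 1 != 0.
Proof. by apply/eqP => /(congr1 (@^~ 0%N))/eqP; rewrite pser0 oner_eq0. Qed.

HB.instance Definition _ := GRing.Zmodule_isComNzRing.Build pser
  pser_mulA pser_mulC pser_mul1 pser_mulD pser_1neq0.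

Lemma pserM (f g : pser) n : (f * g) n = \sum_(k < n.+1) f k * g (n - k)%N.
Proof. by []. Qed.

Definition pser_unit : {pred pser} := fun f =>
  `[< exists g : pser, g * f = 1 >].
Definition pser_inv (f : pser) : pser :=
  if pselect (exists g : pser, g * f = 1) is left h then projT1 (cid h) else f.

Fact pser_mulVx : {in pser_unit, left_inverse 1 pser_inv *%R}.
Proof.
move=> f /asboolP fu; rewrite /pser_inv; case: pselect => // h.
by case: (cid h).
Qed.
Fact pser_unitPl (f g : pser) : g * f = 1 -> f \in pser_unit.
Proof. by move=> h; apply/asboolP; exists g. Qed.
Fact pser_inv_out : {in [predC pser_unit], pser_inv =1 id}.
Proof.
move=> f; rewrite inE => /negP nu; rewrite /pser_inv; case: pselect => // h.
by case: nu; apply/asboolP.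
Qed.

HB.instance Definition _ := GRing.ComNzRing_hasMulInverse.Build pser
  pser_mulVx pser_unitPl pser_inv_out.

Lemma pser_lead (f : pser) : f != 0 ->
  exists2 n, f n != 0 & forall k, (k < n)%N -> f k = 0.
Proof.
move=> f0; have ex : exists n, f n != 0.
  apply: contrapT => nex; case/eqP: f0; apply: pser_eq => n.
  by apply/eqP/negPn/negP => h; apply: nex; exists n.
case: (ex_minnP ex) => n fn nmin; exists n => // k kn; apply/eqP/negPn/negP.
by move/nmin; rewrite leqNgt kn.
Qed.

Fact pser_idomain (f g : pser) : f * g = 0 -> (f == 0) || (g == 0).
Proof.
move=> fg0; apply: contraT; rewrite negb_or => /andP[/pser_lead[m fm fk]].
case/pser_lead => n gn gk.
have /eqP := congr1 (@^~ (m + n)%N) fg0; rewrite /= pserM pser0.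
have mmn : (m < (m + n).+1)%N by rewrite ltnS leq_addr.
rewrite (bigD1 (Ordinal mmn)) //= addKn big1 ?addr0 => [|i /eqP im].
  by rewrite mulf_eq0 (negPf fm) (negPf gn).
have [im'|mi|e] := ltngtP i m; first by rewrite fk // mul0r.
  by rewrite gk ?mulr0 // ltn_subLR ?ltn_add2r // -ltnS.
by case: im; apply: val_inj.
Qed.

HB.instance Definition _ :=
  GRing.ComUnitRing_isIntegral.Build pser pser_idomain.

Definition pser_of_poly (p : {poly K}) : pser := fun n => p`_n.

Fact pser_of_poly_zmod : zmod_morphism pser_of_poly.
Proof. by move=> p q; apply: pser_eq => n; rewrite /pser_of_poly coefB. Qed.
Fact pser_of_poly_monoid : monoid_morphism pser_of_poly.
Proof.
split; first by apply: pser_eq => -[|n]; rewrite /pser_of_poly coef1.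
by move=> p q; apply: pser_eq => n; rewrite /pser_of_poly coefM.
Qed.
HB.instance Definition _ :=
  GRing.isZmodMorphism.Build _ _ pser_of_poly pser_of_poly_zmod.
HB.instance Definition _ :=
  GRing.isMonoidMorphism.Build _ _ pser_of_poly pser_of_poly_monoid.

Lemma pser_of_poly_inj : injective pser_of_poly.
Proof. by move=> p q h; apply/polyP => i; apply: (congr1 (@^~ i) h). Qed.

End PowerSeries.

(** * Specialization of stable subspaces along a place *)
Section Specialization.
Variables (K : closedFieldType) (L : fieldType) (G : set (L * K)).
Hypothesis hG : partial_hom G.
Hypothesis placeG : forall x, (exists c, G (x, c)) \/ G (x^-1, 0).
Local Notation colsub g := (mxsub id g).

Definition integral x := exists c, G (x, c).
(** Extended by 0 outside the valuation ring, to be total. *)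
Definition residue x
  : K := if pselect (integral x) is left h then projT1 (cid h) else 0.

Lemma residueP x : integral x -> G (x, residue x).
Proof. by rewrite /residue => ix; case: pselect => // h; case: (cid h). Qed.

Lemma residueE x c : G (x, c) -> residue x = c.
Proof. by move=> h; apply: (partial_hom_fun hG _ h); apply: residueP;
  exists c. Qed.

Lemma integralM x y : integral x -> integral y -> integral (x * y).
Proof. by case=> c hc [d hd]; exists (c * d);
  apply: (partial_homM hG hc hd). Qed.

Lemma integral0 : integral 0.
Proof. by exists 0; apply: (partial_hom0 hG). Qed.

Lemma integral1 : integral 1.
Proof. by exists 1; case: hG. Qed.

Lemma residue_sum_mul (I : finType) (x y : I -> L) :
  (forall i, integral (x i)) -> (forall i, integral (y i)) ->
  residue (\sum_i x i * y i) = \sum_i residue (x i) * residue (y i).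
Proof.
move=> ix iy; apply: residueE; rewrite -pairE_sum; apply: partial_hom_sum =>
  // i.
exact: (partial_homM hG (residueP (ix i)) (residueP (iy i))).
Qed.

Lemma integral_sum_mul (I : finType) (x y : I -> L) :
  (forall i, integral (x i)) -> (forall i, integral (y i)) ->
  integral (\sum_i x i * y i).
Proof.
move=> ix iy; exists (\sum_i residue (x i) * residue (y i)).
rewrite -pairE_sum; apply: partial_hom_sum => // i.
exact: (partial_homM hG (residueP (ix i)) (residueP (iy i))).
Qed.

Definition integral_mx m n (A : 'M[L]_(m, n)) := forall i j, integral (A i j).

Lemma integral_mulmx m n p (A : 'M_(m, n)) (B : 'M_(n, p)) :
  integral_mx A -> integral_mx B -> integral_mx (A *m B).
Proof. by move=> iA iB i j; rewrite mxE; apply: integral_sum_mul. Qed.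

Lemma residue_mulmx m n p (A : 'M_(m, n)) (B : 'M_(n, p)) :
  integral_mx A -> integral_mx B ->
  map_mx residue (A *m B) = map_mx residue A *m map_mx residue B.
Proof.
move=> iA iB; apply/matrixP=> i j; rewrite !mxE residue_sum_mul //.
by apply: eq_bigr => k _; rewrite !mxE.
Qed.

(** In a valuation ring, some member of a finite family divides the others. *)
Lemma integral_dominant (s : seq L) : has (predC1 0) s ->
  exists2 y, (y \in s) && (y != 0) & forall z, z \in s -> integral (z / y).
Proof.
elim: s => //= a s IH; case hs: (has _ s); last first.
  rewrite orbF => a0; exists a => [|z]; first by rewrite inE eqxx.
  rewrite inE => /predU1P[->|zs]; first by rewrite mulfV //; apply: integral1.
  suff -> : z = 0 by rewrite mul0r; apply: integral0.
  by apply/eqP/negPn; apply: contraFN hs => z0; apply/hasP; exists z.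
have [y /andP[ys y0] iy] := IH hs => _.
have [a0|a0] := eqVneq a 0.
  exists y => [|z]; first by rewrite inE ys orbT y0.
  rewrite inE => /predU1P[->|]; last exact: iy.
  by rewrite a0 mul0r; apply: integral0.
have [iay|] := placeG (a / y).
  exists y => [|z]; first by rewrite inE ys orbT y0.
  by rewrite inE => /predU1P[->|]; last exact: iy.
rewrite invf_div => iya; exists a => [|z]; first by rewrite inE eqxx.
rewrite inE => /predU1P[->|/iy izy]; first by rewrite mulfV //;
  apply: integral1.
rewrite (_ : z / a = z / y * (y / a)); first by apply: integralM => //;
  exists 0.
by rewrite mulrA mulfVK.
Qed.

(** Cramer's rule: in the basis normalized on the columns f, the coordinates are
    ratios of Pluecker coordinates. *)
Lemma invmx_mul_det r n (W : 'M[L]_(r, n)) (f : 'I_r -> 'I_n) i j :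
  colsub f W \in unitmx ->
  (invmx (colsub f W) *m W) i j
    = \det (colsub [eta f with i |-> j] W) / \det (colsub f W).
Proof.
move=> u; set B := colsub [eta f with i |-> j] W;
  rewrite /invmx u -scalemxAl mxE.
rewrite mulrC; congr (_ / _); rewrite (expand_det_col B i) mxE.
apply: eq_bigr => k _; rewrite !mxE /= eqxx mulrC; congr (_ * _).
rewrite /cofactor; congr (_ * \det _); apply/matrixP=> a b; rewrite !mxE /=.
by rewrite eq_sym (negPf (neq_lift _ _)).
Qed.

(** Properness of the Grassmannian: normalizing at a maximal minor that
    dominates the others gives a basis over the valuation ring that contains an
    identity block, hence stays free after reduction. *)
Lemma integral_basis r n (W : 'M[L]_(r, n)) : row_free W ->
  exists (f : 'I_r -> 'I_n) (T : 'M_r), [/\ T \in unitmx,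
    colsub f (T *m W) = 1%:M & integral_mx (T *m W)].
Proof.
move=> Wf; pose x (h : {ffun 'I_r -> 'I_n}) := \det (colsub h W).
have fullT : row_full W^T by rewrite /row_full mxrank_tr.
have nz : has (predC1 0) [seq x h | h : {ffun 'I_r -> 'I_n}].
  apply/hasP; exists (x (fullrankfun fullT)); first exact: map_f (mem_enum _ _).
  rewrite /= /x -unitfE -unitmxE -unitmx_tr.
  rewrite (_ : _^T = rowsub (fullrankfun fullT) W^T) ?fullrowsub_unit //.
  by apply/matrixP=> i j; rewrite !mxE.
have [y /andP[/mapP[f _ ->] xf0] iy] := integral_dominant nz.
have uf : colsub f W \in unitmx by rewrite unitmxE unitfE.
exists f, (invmx (colsub f W)); split.
- by rewrite unitmx_inv.
- rewrite -[RHS](mulVmx uf); apply/matrixP=> i j; rewrite !mxE.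
  by apply: eq_bigr => k _; rewrite !mxE.
move=> i j; rewrite invmx_mul_det //.
pose h := [ffun k => [eta f with i |-> j] k].
rewrite (_ : \det _ = x h); first by apply/iy/map_f/mem_enum.
by congr (\det _); apply/matrixP=> a b; rewrite !mxE ffunE.
Qed.

(** The identity block of the reduced bases also shows that the matrices C
    describing the action on the subspaces are integral, so that the relation
    B X = C B can be reduced. *)
Lemma specialize_subrep (I J : finType) (s t : J -> I) (n r : I -> nat)
    (X : forall a, 'M[L]_(n (s a), n (t a))) (W : forall i, 'M[L]_(r i, n i)) :
  (forall a, integral_mx (X a)) -> (forall i, row_free (W i)) ->
  (forall a, W (s a) *m X a <= W (t a))%MS ->
  exists B : forall i, 'M[K]_(r i, n i),
    (forall i, row_free (B i)) /\
    forall a, (B (s a) *m map_mx residue (X a) <= B (t a))%MS.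
Proof.
move=> iX Wf WX.
have /fin_all_exists[f /fin_all_exists[T hT]] i := integral_basis (Wf i).
pose B i := T i *m W i.
have fB i : colsub (f i) (B i) = 1%:M by case: (hT i).
have iB i : integral_mx (B i) by case: (hT i).
have colM m k p (g : 'I_p -> 'I_k) (A : 'M[L]_m) (D : 'M_(m, k)) :
  colsub g (A *m D) = A *m colsub g D.
  by apply/matrixP=> a b; rewrite !mxE; apply: eq_bigr => c _; rewrite !mxE.
exists (fun i => map_mx residue (B i)); split.
  move=> i; apply/row_freeP; exists (colsub (f i) 1%:M).
  have -> : map_mx residue (B i) *m colsub (f i) 1%:M
    = map_mx residue (colsub (f i) (B i)).
    rewrite -[in RHS](mulmx1 (B i)); apply/matrixP=> a b; rewrite !mxE.
    rewrite residue_sum_mul; [|exact: iB|]; last first.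
      by move=> k; rewrite !mxE; case: eqP => _;
        [apply: integral1 | apply: integral0].
    apply: eq_bigr => k _; rewrite !mxE; congr (_ * _).
    by apply/esym/residueE; case: eqP => _;
      [case: hG | apply: (partial_hom0 hG)].
  rewrite fB; apply/matrixP=> a b; rewrite !mxE.
  by apply: residueE; case: eqP => _; [case: hG | apply: (partial_hom0 hG)].
move=> a.
have /submxP[C eC] : (B (s a) *m X a <= B (t a))%MS.
  case: (hT (t a)) => uT _ _;
    rewrite (eqmxMfull _ (_ : row_full (T (t a)))) ?row_full_unit //.
  by rewrite -mulmxA; apply: submx_trans (WX a); apply: submxMl.
have iBX := integral_mulmx (iB (s a)) (iX a).
have iC : integral_mx C.
  have := congr1 (colsub (f (t a))) eC.
  have -> : colsub (f (t a)) (C *m B (t a)) = C.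
    rewrite -[RHS]mulmx1 -(fB (t a)).
    by apply/matrixP=> x y; rewrite !mxE; apply: eq_bigr => c _; rewrite !mxE.
  by move=> <- x y; rewrite mxE; apply: iBX.
by rewrite -residue_mulmx // eC residue_mulmx // submxMl.
Qed.

End Specialization.

(** * Representations, exact sequences and ext *)
Section RepBasics.
Variables (K : fieldType) (Q : quiver).
Implicit Types b c d e : dimvec Q.

Lemma exact_of_biprod d e c (N : rep K e) (X : rep K d) (M : rep K c)
    (f : forall i, 'M[K]_(e i, d i)) f' (g : forall i, 'M[K]_(d i, c i)) g' :
  (forall i, biprod (f i) (f' i) (g i) (g' i)) ->
  (forall a, N a *m f (tgt a) = f (src a) *m X a) ->
  (forall a, X a *m g (tgt a) = g (src a) *m M a) ->
  exact_seq N X M.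
Proof.
move=> bp hf hg; exists [ffun i => f i], [ffun i => g i]; split.
- by apply/homP => a; rewrite !ffunE.
- by apply/homP => a; rewrite !ffunE.
move=> i; rewrite !ffunE; split; first exact: biprod_row_free (bp i).
  exact: biprod_ker (bp i).
exact: biprod_row_full (bp i).
Qed.

Lemma biprod_of_exact_seq d e c (N : rep K e) (X : rep K d) (M : rep K c) :
  exact_seq N X M ->
  exists (f : forall i, 'M[K]_(e i, d i)) f' (g : forall i, 'M[K]_(d i, c i))
    g',
    [/\ forall i, biprod (f i) (f' i) (g i) (g' i),
        forall a, N a *m f (tgt a) = f (src a) *m X a
      & forall a, X a *m g (tgt a) = g (src a) *m M a].
Proof.
case=> f [g [/homP hf /homP hg ex]].
have /fin_all_exists[f' /fin_all_exists[g' bp]] i :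
    exists f' g', biprod (f i) f' (g i) g'.
  by case: (ex i) => h1 h2 h3; apply: biprod_of_exact.
by exists f, f', g, g'; split.
Qed.

Lemma exact_of_stable d e c (X : rep K d) (f : forall i, 'M[K]_(e i, d i)) :
  (forall i, d i = e i + c i)%N -> (forall i, row_free (f i)) ->
  (forall a, (f (src a) *m X a <= f (tgt a))%MS) ->
  exists (N : rep K e) (M : rep K c), exact_seq N X M.
Proof.
move=> dec fr st.
have /fin_all_exists[f' /fin_all_exists[g /fin_all_exists[g' bp]]] i :
    exists f' g g', @biprod K (e i) (d i) (c i) (f i) f' g g'.
  exact: biprod_of_free.
have /fin_all_exists[N hN] a := submxP (st a).
exists [ffun a => N a], [ffun a => g' (src a) *m X a *m g (tgt a)].
apply: (exact_of_biprod bp) => a; rewrite ffunE ?hN //.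
have [_ _ fg _ _] := bp (tgt a).
rewrite -mulmxA; apply: biprod_factorr (bp _) _.
by rewrite mulmxA hN -mulmxA fg mulmx0.
Qed.

Lemma dim_mxfam (J : finType) (m n : J -> nat) :
  \dim {:mxfam K m n} = \sum_j (m j * n j)%N.
Proof.
transitivity #|{: {j : J & ('I_(m j) * 'I_(n j))%type}}|;
  first by rewrite dimvf.
rewrite card_tagged sumnE big_map big_enum /=.
by apply: eq_bigr => j _; rewrite card_prod !card_ord.
Qed.

Lemma min_hom_le d e (A : rep K d) (B : rep K e) :
  (min_hom K d e <= \dim (hom A B))%N.
Proof.
rewrite /min_hom; case: ex_minnP => m _; apply.
by apply/asboolP; exists A, B.
Qed.

Lemma min_hom_attained d e : exists (A : rep K d) (B : rep K e),
  \dim (hom A B) = min_hom K d e.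
Proof.
rewrite /min_hom; case: ex_minnP => m /asboolP[A [B ->]] _.
by exists A, B.
Qed.

(** The dimension of Ext(A, B), read off the standard resolution. *)
Definition codim_defect d e (A : rep K d) (B : rep K e) : nat :=
  (\sum_(a : arrow Q) d (src a) * e (tgt a)
    - \dim (limg (linfun (defect A B))))%N.

Lemma hom_euler d e (A : rep K d) (B : rep K e) :
  (\dim (hom A B))%:Z - euler d e = (codim_defect A B)%:Z.
Proof.
have h1 : (\dim (limg (linfun (defect A B))) <=
           \sum_(a : arrow Q) d (src a) * e (tgt a))%N.
  by rewrite -(dim_mxfam (fun a : arrow Q => d (src a)) (fun a => e (tgt a)))
    dimvS // subvf.
have h2 := limg_ker_dim (linfun (defect A B)) fullv.
rewrite capfv dim_mxfam in h2.
have sumZ (I : finType) (F : I -> nat) : \sum_i (F i)%:Z = (\sum_i F i)%N%:Z.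
  by rewrite (big_morph Posz PoszD (erefl _)).
rewrite /codim_defect /euler -subzn // !sumZ -h2 PoszD opprB addrCA opprD.
by rewrite [X in _ + X]addrA subrr sub0r.
Qed.

Lemma ext_le d e (A : rep K d) (B : rep K e) :
  ext K d e <= (codim_defect A B)%:Z.
Proof. by rewrite -hom_euler /ext lerD2r lez_nat min_hom_le. Qed.

Lemma ext_attained d e : exists (A : rep K d) (B : rep K e),
  ext K d e = (codim_defect A B)%:Z.
Proof.
have [A [B e0]] := min_hom_attained d e; exists A, B.
by rewrite -hom_euler /ext e0.
Qed.

Lemma ext_ge0 d e : 0 <= ext K d e.
Proof. by have [A [B ->]] := ext_attained d e. Qed.

Lemma codim_defect_eq0 d e (A : rep K d) (B : rep K e) :
  codim_defect A B = 0%N <-> forall h, exists f, defect A B f = h.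
Proof.
have leW : (\dim (limg (linfun (defect A B))) <=
           \sum_(a : arrow Q) d (src a) * e (tgt a))%N.
  by rewrite -(dim_mxfam (fun a : arrow Q => d (src a)) (fun a => e (tgt a)))
    dimvS // subvf.
have E : codim_defect A B = 0%N <-> limg (linfun (defect A B)) = fullv.
  rewrite /codim_defect; split => [/eqP|->].
    rewrite subn_eq0 => h; apply/eqP; rewrite eqEdim subvf dim_mxfam //.
  by rewrite dim_mxfam subnn.
rewrite E; split=> [lim h | surj].
  have : h \in limg (linfun (defect A B)) by rewrite lim memvf.
  by case/memv_imgP => f _ ->; exists f; rewrite lfunE.
apply/vspaceP => h; rewrite memvf; have [f <-] := surj h.
by rewrite -[defect A B f]lfunE memv_img // memvf.
Qed.

(** The form in which vanishing of ext is used: every extension cocycle h is a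
    coboundary. *)
Lemma ext_eq0 d e : ext K d e = 0 <->
  exists (A : rep K d) (B : rep K e), forall h, exists f, defect A B f = h.
Proof.
split=> [e0|[A [B /codim_defect_eq0 AB]]].
  have [A [B]] := ext_attained d e; rewrite e0 => -[] /esym.
  by move/codim_defect_eq0; exists A, B.
by apply/eqP; rewrite eq_le ext_ge0 andbT (le_trans (ext_le A B)) ?AB.
Qed.

End RepBasics.

(** * Vanishing of ext forces subrepresentations *)

(** The condition for the graph of U : K^e -> K^c to be stable under a
    deformation by D of the direct sum of N and M.  Apart from terms containing
    D it is linear in U, given by the map with cokernel Ext(N, M). *)
Lemma graph_stable (R : comNzRingType) (e1 d1 c1 e2 d2 c2 : nat)
    (f1 : 'M[R]_(e1, d1)) (f1' : 'M_(d1, e1)) (g1 : 'M_(d1, c1)) (g1'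
      : 'M_(c1, d1))
    (f2 : 'M_(e2, d2)) (f2' : 'M_(d2, e2)) (g2 : 'M_(d2, c2)) (g2'
      : 'M_(c2, d2))
    (N : 'M_(e1, e2)) (M : 'M_(c1, c2)) (D : 'M_(d1, d2))
    (U1 : 'M_(e1, c1)) (U2 : 'M_(e2, c2)) :
  f1 *m f1' = 1%:M -> g1' *m g1 = 1%:M -> f1 *m g1 = 0 -> g1' *m f1' = 0 ->
  f2 *m f2' = 1%:M -> g2' *m g2 = 1%:M -> f2 *m g2 = 0 -> g2' *m f2' = 0 ->
  f2' *m f2 + g2 *m g2' = 1%:M ->
  N *m U2 - U1 *m M = (f1 + U1 *m g1') *m D *m (g2 - f2' *m U2) ->
  let W := f1 + U1 *m g1' in
  let X := f1' *m N *m f2 + g1 *m M *m g2' + D in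
  W *m X = (W *m X *m f2') *m (f2 + U2 *m g2').
Proof.
move=> a1 a2 a3 a4 b1 b2 b3 b4 b5 eU W X.
have Wf : W *m f1' = 1%:M by rewrite /W mulmxDl a1 -mulmxA a4 mulmx0 addr0.
have Wg : W *m g1 = U1 by rewrite /W mulmxDl a3 -mulmxA a2 mulmx1 add0r.
have WX : W *m X = N *m f2 + U1 *m M *m g2' + W *m D.
  by rewrite /X !mulmxDr !mulmxA Wf Wg mul1mx.
have Z : W *m X *m f2' = N + W *m D *m f2'.
  rewrite WX !mulmxDl -(mulmxA N) b1 mulmx1 -(mulmxA (U1 *m M)) b4 mulmx0.
  by rewrite addr0.
have Wg2 : W *m X *m g2 = U1 *m M + W *m D *m g2.
  rewrite WX !mulmxDl -(mulmxA N) b3 mulmx0 add0r -(mulmxA (U1 *m M)) b2 mulmx1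
    //.
have ZU : W *m X *m f2' *m U2 = W *m X *m g2.
  rewrite Wg2 Z mulmxDl; move/eqP: eU; rewrite -/W mulmxBr mulmxA subr_eq =>
    /eqP ->.
  by rewrite addrAC addrC subrK.
by rewrite [RHS]mulmxDr mulmxA ZU -!(mulmxA (W *m X)) -mulmxDr b5 mulmx1.
Qed.

Section PowerSeriesMatrices.
Variable K : fieldType.

Definition coef_mx k m n (A : 'M[pser K]_(m, n)) : 'M[K]_(m, n) :=
  map_mx (fun f : pser K => f k) A.
Definition const_pmx m n (A : 'M[K]_(m, n)) : 'M[pser K]_(m, n) :=
  map_mx (@pser_of_poly K) (map_mx polyC A).

Lemma coef_mx_eq m n (A B : 'M[pser K]_(m, n)) :
  (forall k, coef_mx k A = coef_mx k B) -> A = B.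
Proof.
move=> h; apply/matrixP=> i j; apply: pser_eq => k.
by have /matrixP/(_ i j) := h k; rewrite !mxE.
Qed.

Lemma coef_mxD k m n (A B : 'M[pser K]_(m, n)) :
  coef_mx k (A + B) = coef_mx k A + coef_mx k B.
Proof. by apply/matrixP=> i j; rewrite !mxE. Qed.

Lemma coef_mxN k m n (A : 'M[pser K]_(m, n)) : coef_mx k (- A) = - coef_mx k A.
Proof. by apply/matrixP=> i j; rewrite !mxE. Qed.

Lemma coef_mxM k m n p (A : 'M[pser K]_(m, n)) (B : 'M_(n, p)) :
  coef_mx k (A *m B) = \sum_(l < k.+1) coef_mx l A *m coef_mx (k - l)%N B.
Proof.
apply/matrixP=> i j; rewrite !mxE summxE pser_sum.
under eq_bigr do rewrite pserM.
rewrite exchange_big; apply: eq_bigr => l _; rewrite mxE.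
by apply: eq_bigr => r _; rewrite !mxE.
Qed.

Lemma coef_const_pmx k m n (A : 'M[K]_(m, n)) :
  coef_mx k (const_pmx A) = if k is 0 then A else 0.
Proof.
by apply/matrixP=> i j; rewrite !mxE /pser_of_poly coefC; case: k => //= k;
  rewrite mxE.
Qed.

Lemma coef_mxMl k m n p (A : 'M[K]_(m, n)) (B : 'M_(n, p)) :
  coef_mx k (const_pmx A *m B) = A *m coef_mx k B.
Proof.
rewrite coef_mxM big_ord_recl coef_const_pmx subn0 big1 ?addr0 // => i _.
by rewrite coef_const_pmx mul0mx.
Qed.

Lemma coef_mxMr k m n p (A : 'M[pser K]_(m, n)) (B : 'M_(n, p)) :
  coef_mx k (A *m const_pmx B) = coef_mx k A *m B.
Proof.
rewrite coef_mxM big_ord_recr /= subnn coef_const_pmx big1 ?add0r // => i _.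
have -> : (k - i = (k - i.+1).+1)%N by rewrite subnSK.
by rewrite coef_const_pmx mulmx0.
Qed.

Lemma coef_mxX k m n (A : 'M[pser K]_(m, n)) :
  coef_mx k (pser_of_poly 'X *: A) = if k is k'.+1 then coef_mx k' A else 0.
Proof.
apply/matrixP=> i j; rewrite !mxE pserM /pser_of_poly.
case: k => [|k]; first by rewrite big_ord1 coefX mul0r mxE.
rewrite big_ord_recl coefX mul0r add0r big_ord_recl coefX mul1r subSS subn0.
rewrite big1 ?addr0 ?mxE // => l _.
by rewrite coefX mul0r.
Qed.

End PowerSeriesMatrices.

(** Definition by recursion on all previous terms.  The iterates of the
    recursion from any start become stationary in each degree. *)
Lemma causal_recursion (T : Type) (x0 : T) (step : nat -> (nat -> T) -> T) :
  (forall n u v, (forall k, (k <= n)%N -> u k = v k) -> step n u = step n v) ->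
  exists u : nat -> T, u 0%N = x0 /\ forall n, u n.+1 = step n u.
Proof.
move=> stepE.
pose nxt (v : nat -> T) n := if n is k.+1 then step k v else x0.
pose v m := iter m nxt (fun _ => x0).
have stab n m : (n <= m)%N -> v m n = v n n.
  elim/ltn_ind: n m => -[|n] IH [|m] // nm.
  by rewrite /v /= -/(v m) -/(v n); apply: stepE => k kn;
    rewrite !IH // (leq_trans kn).
exists (fun n => v n n); split=> // n; rewrite {1}/v /= -/(v n).
by apply: stepE => k kn; rewrite stab.
Qed.

Section GeneralSubrepresentation.
Variables (K : closedFieldType) (Q : quiver).
Implicit Types c d e : dimvec Q.

(** On the line from the direct sum of N and M to X, a stable graph of a power
    series U with U = 0 at t = 0 is sought.  With s a section of the defect map,
    which is onto since Ext(N, M) = 0, the equation of [graph_stable] follows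
    from the fixed-point equation U = t s(psi(U)), solved degree by degree.  The
    resulting subspace lives over the Laurent series and is specialized to
    t = 1. *)
Theorem subrep_of_ext0 d e c : (forall i, d i = e i + c i)%N -> ext K e c = 0 ->
  forall X : rep K d, exists (N : rep K e) (M : rep K c), exact_seq N X M.
Proof.
move=> dec /ext_eq0[N [M surj]] X.
have /fin_all_exists[f
  /fin_all_exists[f' /fin_all_exists[g /fin_all_exists[g' bp]]]] i :
    exists f f' g g', @biprod K (e i) (d i) (c i) f f' g g'.
  by rewrite dec; apply: biprod_exists.
pose D a := X a - (f' (src a) *m N a *m f (tgt a) + g (src a) *m M a
  *m g' (tgt a)).
have DE a : X a - D a = f' (src a) *m N a *m f (tgt a) + g (src a) *m M a
  *m g' (tgt a).
  by rewrite /D subKr.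
clearbody D.
(* The n-th coefficients of the graph of U and of its obstruction. *)
pose w (u : nat -> vmap K e c) k i :=
  (if k is 0 then f i else 0) + u k i *m g' i.
pose psi n u : mxfam K (fun a : arrow Q => e (src a)) (fun a => c (tgt a)) :=
  [ffun a => w u n (src a) *m D a *m g (tgt a)
   - \sum_(l < n.+1) w u l (src a) *m D a *m f' (tgt a) *m u (n - l)%N (tgt a)].
have [s hs] := choice surj.
have [u [u0 uS]] : exists u : nat -> vmap K e c, u 0%N = 0 /\ forall n, u n.+1
  = s (psi n u).
  apply: causal_recursion => n u v uv; congr s; apply/ffunP=> a.
  have wE k i : (k <= n)%N -> w u k i = w v k i by move=> kn; rewrite /w uv.
  rewrite !ffunE wE //; congr (_ - _); apply: eq_bigr => l _.
  by rewrite wE -1?ltnS // uv // leq_subr.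
pose U i : 'M[pser K]_(e i, c i) :=
  \matrix_(x, y) ((fun n => u n i x y) : pser K).
have cU k i : coef_mx k (U i) = u k i by apply/matrixP=> x y; rewrite !mxE.
pose kk := @const_pmx K.
pose W i := kk _ _ (f i) + U i *m kk _ _ (g' i).
have cW k i : coef_mx k (W i) = w u k i.
  by rewrite coef_mxD coef_const_pmx coef_mxMr cU.
have WE i : W i = kk _ _ (f i) + U i *m kk _ _ (g' i) by [].
clearbody W.
pose t : pser K := pser_of_poly 'X.
have kkM m n p (A : 'M[K]_(m, n)) (B : 'M_(n, p)) : kk _ _ (A *m B)
  = kk _ _ A *m kk _ _ B.
  by rewrite /kk /const_pmx !map_mxM.
have kk1 n : kk n n 1%:M = 1%:M by rewrite /kk /const_pmx !map_mx1.
have kk0 m n : kk m n 0 = 0 by rewrite /kk /const_pmx !map_mx0.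
have kkD m n (A B : 'M[K]_(m, n)) : kk _ _ (A + B) = kk _ _ A + kk _ _ B.
  by rewrite /kk /const_pmx !map_mxD.
have cB k m n (A B : 'M[pser K]_(m, n)) : coef_mx k (A - B)
  = coef_mx k A - coef_mx k B.
  by apply/matrixP=> i j; rewrite !mxE.
have eqU a : kk _ _ (N a) *m U (tgt a) - U (src a) *m kk _ _ (M a) =
    W (src a) *m (t *: kk _ _ (D a))
      *m (kk _ _ (g (tgt a)) - kk _ _ (f' (tgt a)) *m U (tgt a)).
  apply: coef_mx_eq => k.
  rewrite -scalemxAr -scalemxAl coef_mxX coef_mxD coef_mxN coef_mxMl coef_mxMr
    !cU.
  case: k => [|k]; first by rewrite u0 !ffunE mulmx0 mul0mx subrr.
  have := hs (psi k u); rewrite -uS => /ffunP/(_ a); rewrite !ffunE => ->.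
  rewrite mulmxBr cB !coef_mxMr cW; congr (_ - _).
  rewrite mulmxA coef_mxM; apply: eq_bigr => l _.
  by rewrite !coef_mxMr cW cU.
pose Xp a : 'M[{poly K}]_(d (src a), d (tgt a)) :=
  map_mx polyC (X a - D a) + 'X *: map_mx polyC (D a).
pose Xt a := map_mx (@pser_of_poly K) (Xp a).
have XtE a : Xt a = kk _ _ (f' (src a)) *m kk _ _ (N a) *m kk _ _ (f (tgt a))
     + kk _ _ (g (src a)) *m kk _ _ (M a) *m kk _ _ (g' (tgt a))
         + t *: kk _ _ (D a).
  rewrite /Xt /Xp map_mxD map_mxZ DE.
  by rewrite -[map_mx _ (map_mx _ _)]/(kk _ _ _) kkD !kkM.
have stab a : W (src a) *m Xt a
  = W (src a) *m Xt a *m kk _ _ (f' (tgt a)) *m W (tgt a).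
  have [a1 a2 a3 a4 a5] := bp (src a); have [b1 b2 b3 b4 b5] := bp (tgt a).
  have eqUa := eqU a; rewrite WE in eqUa.
  rewrite XtE !WE; apply: graph_stable eqUa;
    by rewrite -?kkM -?kkD ?(a1, a2, a3, a4, b1, b2, b3, b4, b5) ?kk1 ?kk0.
pose L := {fraction (pser K)}.
pose io : {poly K} -> L := @tofrac (pser K) \o @pser_of_poly K.
have io_inj p : io p = 0 -> p = 0.
  move/eqP; rewrite /io /= tofrac_eq0 => /eqP h; apply: (@pser_of_poly_inj K).
  by rewrite h rmorph0.
(* The morphism K[t] -> K, t |-> 1, seen inside Laurent series x K. *)
pose S : set (L * K) := [set v | exists p, v = (io p, p.[1])]%classic.
have hS : partial_hom S.
  split.
  - by exists 1; rewrite hornerC /io /= !rmorph1.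
  - by move=> _ _ [p ->] [q ->]; exists (p - q);
      rewrite hornerD hornerN /io /= !rmorphB.
  - by move=> _ _ [p ->] [q ->]; exists (p * q);
      rewrite hornerM /io /= !rmorphM.
  - by move=> x; exists (io x%:P), x%:P; rewrite hornerC.
  by move=> x [p [/esym/io_inj -> ->]]; rewrite horner0.
have [G [SG hG placeG]] := place_extension hS.
pose fr m n (A : 'M[pser K]_(m, n)) : 'M[L]_(m, n) :=
  map_mx (@tofrac (pser K)) A.
have XG a i j : G (fr _ _ (Xt a) i j, X a i j).
  apply: SG; exists (Xp a i j); rewrite !mxE /io /=; congr (_, _).
  by rewrite !hornerE subrK.
have [|||B [Bf BX]] :=
  @specialize_subrep K L G hG placeG _ _ (@src Q) (@tgt Q) d e
   (fun a => fr _ _ (Xt a)) (fun i => fr _ _ (W i)).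
- by move=> a i j; exists (X a i j); apply: XG.
- move=> i; apply/row_freeP; exists (fr _ _ (kk _ _ (f' i))).
  have [a1 a2 a3 a4 a5] := bp i.
  by rewrite /fr -map_mxM WE mulmxDl -mulmxA -!kkM a1 a4 kk0 mulmx0 addr0 kk1
    map_mx1.
- by move=> a; rewrite /fr -map_mxM stab map_mxM submxMl.
apply: (exact_of_stable dec Bf) => a.
rewrite (_ : X a = map_mx (residue G) (fr _ _ (Xt a))) ?BX //.
by apply/matrixP=> i j; rewrite mxE (residueE hG (XG a i j)).
Qed.

End GeneralSubrepresentation.

(** * Hom spaces of direct sums *)
Lemma sub_swap (V : zmodType) (x y z t : V) : x - y = z - t -> x - z = y - t.
Proof.
move=> h; apply/eqP; rewrite subr_eq; apply/eqP.
by rewrite -[x](subrK y) h addrC addrA addrAC.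
Qed.

Section Composition.
Variables (K : fieldType) (I : finType).
Variables m n p : I -> nat.

Definition precomp (f : forall i, 'M[K]_(m i, n i)) (h : mxfam K n p)
  : mxfam K m p :=
  [ffun i => f i *m h i].
Definition postcomp (f : forall i, 'M[K]_(n i, p i)) (h : mxfam K m n)
  : mxfam K m p :=
  [ffun i => h i *m f i].

Fact precomp_linear f : linear (precomp f).
Proof.
move=> a h k; apply/ffunP=> i; rewrite mxfamDE mxfamZE !ffunE mulmxDr.
by rewrite -scalemxAr.
Qed.
Fact postcomp_linear f : linear (postcomp f).
Proof.
move=> a h k; apply/ffunP=> i; rewrite mxfamDE mxfamZE !ffunE mulmxDl.
by rewrite -scalemxAl.
Qed.
HB.instance Definition _ f :=
  GRing.isLinear.Build K _ _ _ (precomp f) (precomp_linear f).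
HB.instance Definition _ f :=
  GRing.isLinear.Build K _ _ _ (postcomp f) (postcomp_linear f).
End Composition.

Lemma dim_biprod (K : fieldType) (V V1 V2 : vectType K)
    (U : {vspace V}) (U1 : {vspace V1}) (U2 : {vspace V2})
    (p1 : {linear V -> V1}) (i1 : {linear V1 -> V})
    (p2 : {linear V -> V2}) (i2 : {linear V2 -> V}) :
  (forall u, u \in U -> p1 u \in U1) -> (forall u, u \in U1 -> i1 u \in U) ->
  (forall u, u \in U -> p2 u \in U2) -> (forall u, u \in U2 -> i2 u \in U) ->
  cancel i1 p1 -> cancel i2 p2 -> (forall u, p1 (i2 u) = 0) ->
  (forall u, i1 (p1 u) + i2 (p2 u) = u) ->
  \dim U = (\dim U1 + \dim U2)%N.
Proof.
move=> hp1 hi1 hp2 hi2 K1 K2 p1i2 S.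
rewrite -(limg_ker_dim (linfun p1) U) addnC; congr (_ + _)%N; last first.
  have -> : (U :&: lker (linfun p1) = linfun i2 @: U2)%VS.
    apply/vspaceP=> u; rewrite memv_cap memv_ker lfunE; apply/andP/memv_imgP.
      case=> uU /eqP p1u; exists (p2 u); first exact: hp2.
      by rewrite lfunE -[LHS]S p1u linear0 add0r.
    by case=> v vU2 ->; rewrite lfunE p1i2 eqxx hi2.
  rewrite limg_dim_eq //; apply/eqP; rewrite -subv0; apply/subvP=> u.
  rewrite memv_cap memv_ker lfunE memv0 => /andP[_ /eqP i2u].
  by rewrite -(K2 u) /= i2u linear0.
congr (\dim _); apply/vspaceP=> u; apply/memv_imgP/idP.
  by case=> v vU ->; rewrite lfunE hp1.
by move=> uU1; exists (i1 u); rewrite ?hi1 // lfunE /= K1.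
Qed.

Section DirectSums.
Variables (K : fieldType) (Q : quiver).
Implicit Types c d e x : dimvec Q.

Definition is_dsum d e c (N : rep K e) (X : rep K d) (M : rep K c) : Prop :=
  exists (f : forall i, 'M[K]_(e i, d i)) f' (g : forall i, 'M[K]_(d i, c i))
    g',
    [/\ forall i, biprod (f i) (f' i) (g i) (g' i),
        forall a, N a *m f (tgt a) = f (src a) *m X a,
        forall a, X a *m g (tgt a) = g (src a) *m M a,
        forall a, X a *m f' (tgt a) = f' (src a) *m N a
      & forall a, M a *m g' (tgt a) = g' (src a) *m X a].

Lemma hom_dsum_l d e c x (N : rep K e) (X : rep K d) (M : rep K c) (C : rep K x)
  :
  is_dsum N X M -> \dim (hom X C) = (\dim (hom N C) + \dim (hom M C))%N.
Proof.
case=> f [f' [g [g' [bp hf hg hf' hg']]]].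
apply: (dim_biprod (p1 := precomp f) (i1 := precomp f') (p2 := precomp g')
  (i2 := precomp g)).
- move=> u /homP hu; apply/homP=> a; rewrite !ffunE mulmxA hf -!mulmxA.
  by rewrite hu.
- move=> u /homP hu; apply/homP=> a; rewrite !ffunE mulmxA hf' -!mulmxA.
  by rewrite hu.
- move=> u /homP hu; apply/homP=> a; rewrite !ffunE mulmxA hg' -!mulmxA.
  by rewrite hu.
- move=> u /homP hu; apply/homP=> a; rewrite !ffunE mulmxA hg -!mulmxA.
  by rewrite hu.
- move=> u; apply/ffunP=> i; rewrite !ffunE mulmxA; have [-> _ _ _ _] := bp i.
  by rewrite mul1mx.
- move=> u; apply/ffunP=> i; rewrite !ffunE mulmxA; have [_ -> _ _ _] := bp i.
  by rewrite mul1mx.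
- move=> u; apply/ffunP=> i; rewrite !ffunE mulmxA; have [_ _ -> _ _] := bp i.
  by rewrite mul0mx.
move=> u; apply/ffunP=> i; rewrite mxfamDE !ffunE !mulmxA -mulmxDl.
by have [_ _ _ _ ->] := bp i; rewrite mul1mx.
Qed.

Lemma hom_dsum_r d e c x (N : rep K e) (X : rep K d) (M : rep K c) (C : rep K x)
  :
  is_dsum N X M -> \dim (hom C X) = (\dim (hom C N) + \dim (hom C M))%N.
Proof.
case=> f [f' [g [g' [bp hf hg hf' hg']]]].
apply: (dim_biprod (p1 := postcomp f') (i1 := postcomp f) (p2 := postcomp g)
  (i2 := postcomp g')).
- move=> u /homP hu; apply/homP=> a; rewrite !ffunE mulmxA hu -!mulmxA.
  by rewrite hf'.
- move=> u /homP hu; apply/homP=> a; rewrite !ffunE mulmxA hu -!mulmxA.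
  by rewrite hf.
- move=> u /homP hu; apply/homP=> a; rewrite !ffunE mulmxA hu -!mulmxA.
  by rewrite hg.
- move=> u /homP hu; apply/homP=> a; rewrite !ffunE mulmxA hu -!mulmxA.
  by rewrite hg'.
- move=> u; apply/ffunP=> i; rewrite !ffunE -mulmxA; have [-> _ _ _ _] := bp i.
  by rewrite mulmx1.
- move=> u; apply/ffunP=> i; rewrite !ffunE -mulmxA; have [_ -> _ _ _] := bp i.
  by rewrite mulmx1.
- move=> u; apply/ffunP=> i; rewrite !ffunE -mulmxA; have [_ _ _ -> _] := bp i.
  by rewrite mulmx0.
move=> u; apply/ffunP=> i; rewrite mxfamDE !ffunE -!mulmxA -mulmxDr.
by have [_ _ _ _ ->] := bp i; rewrite mulmx1.
Qed.

Lemma dsum_exists d e c (N : rep K e) (M : rep K c) :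
  (forall i, d i = e i + c i)%N -> exists X : rep K d, is_dsum N X M.
Proof.
move=> dec.
have /fin_all_exists[f
  /fin_all_exists[f' /fin_all_exists[g /fin_all_exists[g' bp]]]] i :
    exists f f' g g', @biprod K (e i) (d i) (c i) f f' g g'.
  by rewrite dec; apply: biprod_exists.
exists [ffun a => f' (src a) *m N a *m f (tgt a) + g (src a) *m M a
  *m g' (tgt a)].
exists f, f', g, g'; split=> // a; rewrite ffunE;
  have [a1 a2 a3 a4 a5] := bp (src a); have [b1 b2 b3 b4 b5] := bp (tgt a).
- by rewrite mulmxDr !mulmxA a1 a3 mul1mx !mul0mx addr0.
- by rewrite mulmxDl -!mulmxA b3 b2 !mulmx0 mulmx1 add0r.
- by rewrite mulmxDl -!mulmxA b1 b4 !mulmx0 mulmx1 addr0.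
by rewrite mulmxDr !mulmxA a2 a4 mul1mx !mul0mx add0r.
Qed.

(** A linear section g' of g fails to be a morphism by a cocycle with values in
    N, which Ext(M, N) = 0 allows to correct by k. *)
Lemma split_exact d e c (N : rep K e) (X : rep K d) (M : rep K c)
    (f : forall i, 'M[K]_(e i, d i)) f' (g : forall i, 'M[K]_(d i, c i)) g' :
  (forall i, biprod (f i) (f' i) (g i) (g' i)) ->
  (forall a, N a *m f (tgt a) = f (src a) *m X a) ->
  (forall a, X a *m g (tgt a) = g (src a) *m M a) ->
  (forall h, exists k, defect M N k = h) -> is_dsum N X M.
Proof.
move=> bp hf hg surj.
have [k hk] := surj [ffun a => (M a *m g' (tgt a) - g' (src a) *m X a)
  *m f' (tgt a)].
pose f2 i := f' i + g i *m k i; pose g2 i := g' i - k i *m f i.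
have bp2 i : biprod (f i) (f2 i) (g i) (g2 i).
  have [h1 h2 h3 h4 h5] := bp i; split=> //.
  - by rewrite mulmxDr h1 mulmxA h3 mul0mx addr0.
  - by rewrite mulmxBl h2 -mulmxA h3 mulmx0 subr0.
  - rewrite mulmxBl !mulmxDr h4 !mulmxA h2 mul1mx -!mulmxA h1 (mulmxA (f i)) h3.
    by rewrite mul0mx mulmx0 mulmx1 add0r addr0 subrr.
  by rewrite mulmxDl mulmxBr mulmxA addrACA subrr addr0 h5.
have hg2 a : M a *m g2 (tgt a) = g2 (src a) *m X a.
  have [_ h2 _ _ _] := bp (src a); have [_ b2 _ _ _] := bp (tgt a).
  have z : (M a *m g' (tgt a) - g' (src a) *m X a) *m g (tgt a) = 0.
    by rewrite mulmxBl -!mulmxA b2 hg mulmx1 mulmxA h2 mul1mx subrr.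
  have := biprod_factorl (bp (tgt a)) z.
  have /ffunP/(_ a) := hk; rewrite !ffunE => <-.
  rewrite mulmxBl -!mulmxA hf => /sub_swap.
  by rewrite mulmxBr mulmxBl -!mulmxA.
exists f, f2, g, g2; split=> // a.
have [h1 h2 h3 h4 h5] := bp2 (src a); have [b1 b2 b3 b4 b5] := bp2 (tgt a).
rewrite -[X a]mul1mx -h5 !mulmxDl -!mulmxA (mulmxA (f _)) -hf (mulmxA (g2 _))
  -hg2.
by rewrite -!mulmxA b1 b4 !mulmx0 mulmx1 addr0.
Qed.

End DirectSums.

(** * Subadditivity and additivity of ext *)
Section GenericHom.
Variables (K : closedFieldType) (Q : quiver).
Implicit Types c d e x : dimvec Q.

Lemma defect_pencil d e (A0 A1 : rep K d) (B0 B1 : rep K e) (s : K) :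
  linfun (defect (A0 + s *: A1) (B0 + s *: B1))
    = linfun (defect A0 B0) + s *: linfun (defect A1 B1).
Proof.
apply/lfunP=> f; rewrite add_lfunE scale_lfunE !lfunE /=; apply/ffunP=> a.
rewrite !(mxfamDE, mxfamZE, ffunE) mulmxDl mulmxDr -scalemxAl -scalemxAr.
by rewrite scalerBr addrACA opprD.
Qed.

Lemma hom_generic d e (A0 A1 : rep K d) (B0 B1 : rep K e) (s0 : K) :
  exists2 p : {poly K}, p.[s0] != 0 & forall s, p.[s] != 0 ->
    (\dim (hom (A0 + s *: A1)%R (B0 + s *: B1)%R)
       <= \dim (hom (A0 + s0 *: A1)%R (B0 + s0 *: B1)%R))%N.
Proof.
have [p p0 hp] := ker_pencil_generic (linfun (defect A0 B0))
  (linfun (defect A1 B1)) s0.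
by exists p => // s /hp; rewrite /hom !defect_pencil.
Qed.

Lemma horner_neq0 (p : {poly K}) s : p.[s] != 0 -> p != 0.
Proof. by apply: contraNneq => ->; rewrite horner0. Qed.

Lemma line_end (V : lmodType K) (u v : V) : u + 1 *: (v - u) = v.
Proof. by rewrite scale1r addrC subrK. Qed.

Lemma line_start (V : lmodType K) (u v : V) : u + 0 *: v = u.
Proof. by rewrite scale0r addr0. Qed.

Lemma line_const (V : lmodType K) (u : V) s : u + s *: 0 = u.
Proof. by rewrite scaler0 addr0. Qed.

(** The optimal second arguments for e and for c need not be the same; a general
    point of the line joining them is good for both. *)
Lemma min_homDl_le d e c x : (forall i, d i = e i + c i)%N ->
  (min_hom K d x <= min_hom K e x + min_hom K c x)%N.
Proof.
move=> dec; have [N [C1 hN]] := min_hom_attained K e x.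
have [M [C2 hM]] := min_hom_attained K c x.
have [p p0 hp] := hom_generic N 0 C1 (C2 - C1) 0.
have [q q1 hq] := hom_generic M 0 C1 (C2 - C1) 1.
have [s [/hp ps /hq qs]] := generic_point (horner_neq0 p0) (horner_neq0 q1).
rewrite !line_const line_start hN in ps; rewrite !line_const line_end hM in qs.
have [X NXM] := dsum_exists N M dec.
apply: leq_trans (leq_add ps qs).
by rewrite -(hom_dsum_l _ NXM) min_hom_le.
Qed.

Lemma min_homDr_le d e c x : (forall i, d i = e i + c i)%N ->
  (min_hom K x d <= min_hom K x e + min_hom K x c)%N.
Proof.
move=> dec; have [C1 [N hN]] := min_hom_attained K x e.
have [C2 [M hM]] := min_hom_attained K x c.
have [p p0 hp] := hom_generic C1 (C2 - C1) N 0 0.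
have [q q1 hq] := hom_generic C1 (C2 - C1) M 0 1.
have [s [/hp ps /hq qs]] := generic_point (horner_neq0 p0) (horner_neq0 q1).
rewrite !line_const line_start hN in ps; rewrite !line_const line_end hM in qs.
have [X NXM] := dsum_exists N M dec.
apply: leq_trans (leq_add ps qs).
by rewrite -(hom_dsum_r _ NXM) min_hom_le.
Qed.

(** When ext vanishes both ways, direct sums are dense: by the first vanishing X
    has a subspace of dimension e that is stable, and along the line inside
    the representations with this stable subspace, from a direct sum of M0 and
    N0 with Ext(M0, N0) = 0 to X, the general exact sequence splits by the
    second vanishing. *)
Lemma generic_dsum d e c (X : rep K d) : (forall i, d i = e i + c i)%N ->
  ext K e c = 0 -> ext K c e = 0 ->
  exists (X1 : rep K d) (q : {poly K}), q != 0 /\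
    forall s, q.[s] != 0 -> exists (N : rep K e) (M : rep K c),
      is_dsum N (X1 + s *: (X - X1)) M.
Proof.
move=> dec ec0 /ext_eq0[M0 [N0 surj]].
have [N1 [M1 /biprod_of_exact_seq[f [f' [g [g' [bp hf hg]]]]]]] :=
  subrep_of_ext0 dec ec0 X.
pose X0 : rep K d :=
  [ffun a => f' (src a) *m N0 a *m f (tgt a) + g (src a) *m M0 a *m g' (tgt a)].
have [q q0 hq] := hom_generic M0 (M1 - M0) N0 (N1 - N0) 0.
exists X0, q; split; first exact: horner_neq0 q0.
move=> s /hq; rewrite !line_start => hs.
set N := N0 + s *: (N1 - N0) in hs; set M := M0 + s *: (M1 - M0) in hs.
have : codim_defect M N = 0%N.
  apply/eqP; rewrite -leqn0 -lez_nat -(hom_euler M N)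
    -((codim_defect_eq0 M0 N0).2 surj).
  by rewrite -(hom_euler M0 N0) lerD2r lez_nat.
move/codim_defect_eq0 => surjs; exists N, M;
  apply: (split_exact bp _ _ surjs) => a.
- rewrite /N !(mxfamDE, mxfamZE) mulmxDl mulmxDr -scalemxAl -scalemxAr.
  have -> : N0 a *m f (tgt a) = f (src a) *m X0 a.
    have [a1 a2 a3 a4 a5] := bp (src a).
    by rewrite ffunE mulmxDr !mulmxA a1 a3 mul1mx !mul0mx addr0.
  congr (_ + _ *: _); rewrite !ffunE mulmxBl mulmxBr hf; congr (_ - _).
  have [a1 a2 a3 a4 a5] := bp (src a).
  by rewrite mulmxDr !mulmxA a1 a3 mul1mx !mul0mx addr0.
rewrite /M !(mxfamDE, mxfamZE) mulmxDl mulmxDr -scalemxAl -scalemxAr.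
have X0g : X0 a *m g (tgt a) = g (src a) *m M0 a.
  have [b1 b2 b3 b4 b5] := bp (tgt a).
  by rewrite ffunE mulmxDl -!mulmxA b3 b2 !mulmx0 mulmx1 add0r.
have E (m n : arrow Q -> nat) (u : mxfam K m n) b : (- u) b
  = - u b by rewrite ffunE.
by rewrite X0g !E mulmxBl mulmxBr hg X0g.
Qed.

Lemma min_homDl_ge d e c x : (forall i, d i = e i + c i)%N ->
  ext K e c = 0 -> ext K c e = 0 ->
  (min_hom K e x + min_hom K c x <= min_hom K d x)%N.
Proof.
move=> dec ec ce; have [X [C hXC]] := min_hom_attained K d x.
have [X1 [q [q0 hq]]] := generic_dsum X dec ec ce.
have [p p1 hp] := hom_generic X1 (X - X1) C 0 1.
have [s [/hq[N [M NXM]] /hp hs]] := generic_point q0 (horner_neq0 p1).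
move: hs; rewrite !line_const line_end hXC; apply: leq_trans.
by rewrite (hom_dsum_l _ NXM) leq_add // min_hom_le.
Qed.

Lemma min_homDr_ge d e c x : (forall i, d i = e i + c i)%N ->
  ext K e c = 0 -> ext K c e = 0 ->
  (min_hom K x e + min_hom K x c <= min_hom K x d)%N.
Proof.
move=> dec ec ce; have [C [X hXC]] := min_hom_attained K x d.
have [X1 [q [q0 hq]]] := generic_dsum X dec ec ce.
have [p p1 hp] := hom_generic C 0 X1 (X - X1) 1.
have [s [/hq[N [M NXM]] /hp hs]] := generic_point q0 (horner_neq0 p1).
move: hs; rewrite !line_const line_end hXC; apply: leq_trans.
by rewrite (hom_dsum_r _ NXM) leq_add // min_hom_le.
Qed.

Lemma eulerDl d e x : euler (d + e) x = euler d x + euler e x.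
Proof.
rewrite /euler addrACA -opprD -!big_split /=; congr (_ - _); apply: eq_bigr =>
  i _;
by rewrite ffunE mulnDl PoszD.
Qed.

Lemma eulerDr d e x : euler x (d + e) = euler x d + euler x e.
Proof.
rewrite /euler addrACA -opprD -!big_split /=; congr (_ - _); apply: eq_bigr =>
  i _;
by rewrite ffunE mulnDr PoszD.
Qed.

Lemma extDl_le d e x : ext K (d + e) x <= ext K d x + ext K e x.
Proof.
rewrite /ext eulerDl [leRHS]addrACA -opprD lerD2r -PoszD lez_nat.
by apply: min_homDl_le => i; rewrite ffunE.
Qed.

Lemma extDr_le d e x : ext K x (d + e) <= ext K x d + ext K x e.
Proof.
rewrite /ext eulerDr [leRHS]addrACA -opprD lerD2r -PoszD lez_nat.
by apply: min_homDr_le => i; rewrite ffunE.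
Qed.

Lemma extDl d e x : ext K d e = 0 -> ext K e d = 0 ->
  ext K (d + e) x = ext K d x + ext K e x.
Proof.
move=> de ed; apply/eqP; rewrite eq_le extDl_le /=.
rewrite /ext eulerDl [leLHS]addrACA -opprD lerD2r -PoszD lez_nat.
by apply: min_homDl_ge => // i; rewrite ffunE.
Qed.

Lemma extDr d e x : ext K d e = 0 -> ext K e d = 0 ->
  ext K x (d + e) = ext K x d + ext K x e.
Proof.
move=> de ed; apply/eqP; rewrite eq_le extDr_le /=.
rewrite /ext eulerDr [leLHS]addrACA -opprD lerD2r -PoszD lez_nat.
by apply: min_homDr_ge => // i; rewrite ffunE.
Qed.

End GenericHom.

(** * Endomorphisms: idempotents, nilpotents and ranks *)
Lemma sum_leq_eq (I : finType) (F G : I -> nat) :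
  (forall i, F i <= G i)%N -> (\sum_i G i <= \sum_i F i)%N -> forall i, F i
    = G i.
Proof.
move=> FG GF i; have h j : true -> (F j <= G j ?= iff (F j == G j))%N by [].
have [hle] := leqif_sum h; rewrite eqn_leq hle GF => /esym/forallP/(_ i)/eqP.
exact.
Qed.

(** If G and its square have the same rank then G has a group inverse; here
    G H = H' G is the projector onto im G along ker G. *)
Lemma rank_square_factor (K : fieldType) n (G : 'M[K]_n) :
  \rank (G *m G) = \rank G -> exists H H', G = G *m G *m H /\ G
    = H' *m (G *m G).
Proof.
have row (A : 'M[K]_n) : \rank (A *m A) = \rank A -> exists H, A
  = H *m (A *m A).
  move=> rA; apply/submxP.
  by rewrite -(geq_leqif (mxrank_leqif_sup (submxMl A A))) rA.
move=> rG; have [H' eH'] := row _ rG.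
have [|Z eZ] := row G^T; first by rewrite -trmx_mul !mxrank_tr.
exists Z^T, H'; split=> //.
by rewrite -[LHS]trmxK eZ trmx_mul trmx_mul !trmxK.
Qed.

Lemma mxtrace_nilpotent (K : closedFieldType) n (A : 'M[K]_n) m :
  A ^+ m = 0 -> \tr A = 0.
Proof.
case: n A => [|n] A Am; first by rewrite /mxtrace big_ord0.
have eig z : root (char_poly A) z -> z = 0.
  rewrite -eigenvalue_root_char => /eigenvalueP[v vA v0].
  have vAk k : v *m A ^+ k = z ^+ k *: v.
    elim: k => [|k IH]; first by rewrite expr0 mulmx1 scale1r.
    by rewrite exprS -[_ * _]/(_ *m _) mulmxA vA -scalemxAl IH scalerA -exprS.
  have /eqP := vAk m; rewrite Am mulmx0 eq_sym scaler_eq0 (negPf v0) orbF.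
  by rewrite expf_eq0 => /andP[_ /eqP].
have [rs ers] := closed_field_poly_normal (char_poly A).
have /eqP lc : lead_coef (char_poly A) == 1 by rewrite -monicE char_poly_monic.
rewrite lc scale1r in ers.
have rs0 : rs = nseq (size rs) 0.
  apply/all_pred1P/allP => z zrs; apply/eqP/eig.
  by rewrite ers root_prod_XsubC.
have srs : size rs = n.+1.
  by have := size_char_poly A; rewrite ers size_prod_XsubC => -[].
have cpX : char_poly A = 'X^(n.+1).
  rewrite ers rs0 srs big_nseq subr0.
  by elim: n.+1 => // k IH; rewrite iterS IH exprS.
have := char_poly_trace A (ltn0Sn n); rewrite cpX coefXn /= ltn_eqF //= => /eqP.
by rewrite eq_sym oppr_eq0 => /eqP.
Qed.

Section Endomorphisms.
Variables (K : closedFieldType) (Q : quiver).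
Implicit Types c d e x : dimvec Q.

Definition rank_vec d (f : vmap K d d) : dimvec Q := [ffun i => \rank (f i)].
Definition corank_vec d (f : vmap K d d) : dimvec Q :=
  [ffun i => d i - \rank (f i)]%N.

Lemma rank_corank d (f : vmap K d d) : d = rank_vec f + corank_vec f.
Proof. by apply/ffunP=> i; rewrite !ffunE; apply/esym/subnKC/rank_leq_row. Qed.

(** The coefficient of s in the condition that f + s f1 commutes with the action
    of X + s Y. *)
Definition first_order_lift d (X Y : rep K d) (f f1 : vmap K d d) : Prop :=
  forall a, Y a *m f (tgt a) + X a *m f1 (tgt a)
    = f1 (src a) *m X a + f (src a) *m Y a.

(** Put f = C B with image I, so C : X -> I is onto and B : I -> X is injective.
    The condition on the kernel says that f1 is tangent to the maps of constant
    rank, hence induces h : ker f -> X / ker f = I and k : im f -> X / im f; the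
    lifting equation says that h and k bound the classes of Y in
    Ext(ker f, X / ker f) and in Ext(im f, X / im f).  As Y is arbitrary and
    every cocycle is induced by some Y, both groups vanish. *)
Lemma ext0_of_lifts d (X : rep K d) (f : vmap K d d) : f \in hom X X ->
  (forall Y, exists2 f1, first_order_lift X Y f f1
     & forall i, (kermx (f i) *m f1 i <= f i)%MS) ->
  ext K (corank_vec f) (rank_vec f) = 0 /\ ext K (rank_vec f) (corank_vec f)
    = 0.
Proof.
move=> /homP Xf lift; set b := rank_vec f; set c := corank_vec f.
have dbc i : d i = (b i + c i)%N by rewrite {1}(rank_corank f) ffunE.
have rb i : \rank (f i) = b i by rewrite ffunE.
clearbody b c.
have dcb i : d i = (c i + b i)%N by rewrite addnC.
have /fin_all_exists[C /fin_all_exists[B CB]] i :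
    exists (C : 'M[K]_(d i, b i)) (B : 'M_(b i, d i)),
      [/\ f i = C *m B, row_full C & row_free B].
  exact: row_base_factor.
have fE i : f i = C i *m B i by case: (CB i).
have /fin_all_exists[E /fin_all_exists[E' /fin_all_exists[C' bpC]]] i :
    exists E E' C', @biprod K (c i) (d i) (b i) E E' (C i) C'.
  by apply: biprod_of_full => //; case: (CB i).
have /fin_all_exists[B' /fin_all_exists[P /fin_all_exists[P' bpB]]] i :
    exists B' P P', @biprod K (b i) (d i) (c i) (B i) B' P P'.
  by apply: biprod_of_free => //; case: (CB i).
have EC i : E i *m C i = 0 by case: (bpC i).
have C'C i : C' i *m C i = 1%:M by case: (bpC i).
have BP i : B i *m P i = 0 by case: (bpB i).
have BB' i : B i *m B' i = 1%:M by case: (bpB i).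
have EE' i : E i *m E' i = 1%:M by case: (bpC i).
have P'P i : P' i *m P i = 1%:M by case: (bpB i).
pose J a := C' (src a) *m X a *m C (tgt a).
have BX a : B (src a) *m X a = J a *m B (tgt a).
  rewrite -[LHS]mul1mx -(C'C (src a)) -mulmxA (mulmxA (C _)) -fE -Xf fE.
  by rewrite /J !mulmxA.
clearbody J.
have XC a : X a *m C (tgt a) = C (src a) *m J a.
  rewrite -[LHS]mulmx1 -(BB' (tgt a)) -mulmxA (mulmxA (C _)) -fE mulmxA Xf fE.
  by rewrite -(mulmxA (C _)) BX -!mulmxA BB' mulmx1.
pose N a := E (src a) *m X a *m E' (tgt a).
have EX a : E (src a) *m X a = N a *m E (tgt a).
  rewrite /N; apply: (biprod_factorl (bpC (tgt a))).
  by rewrite -mulmxA XC mulmxA EC mul0mx.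
clearbody N.
pose R a := P' (src a) *m X a *m P (tgt a).
have XP a : X a *m P (tgt a) = P (src a) *m R a.
  rewrite /R -mulmxA; apply: (biprod_factorr (bpB (src a))).
  by rewrite mulmxA BX -mulmxA BP mulmx0.
clearbody R.
have Bfree i (m : nat) (u v : 'M[K]_(m, b i)) : u *m B i = v *m B i -> u = v.
  by move=> h; rewrite -[u]mulmx1 -(BB' i) mulmxA h -mulmxA BB' mulmx1.
have Cfull i (m : nat) (u v : 'M[K]_(b i, m)) : C i *m u = C i *m v -> u = v.
  by move=> h; rewrite -[u]mul1mx -(C'C i) -mulmxA h mulmxA C'C mul1mx.
have lift_ker i (f1 : 'M[K]_(d i)) : (kermx (f i) *m f1 <= f i)%MS ->
    exists h : 'M[K]_(c i, b i), E i *m f1 = h *m B i.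
  move=> kf; apply/submxP; apply: (submx_trans (_ : _ <= f i)%MS).
    apply: submx_trans kf; apply: submxMr; apply/sub_kermxP.
    by rewrite fE mulmxA EC mul0mx.
  by rewrite fE submxMl.
split; apply/ext_eq0.
  exists [ffun a => N a], [ffun a => J a] => Z.
  (* A direction inducing the cocycle Z from ker f to I. *)
  pose Y : rep K d := [ffun a => E' (src a) *m Z a *m C' (tgt a)].
  have [f1 hf1 kf1] := lift Y.
  have /fin_all_exists[h hh] i := lift_ker i (f1 i) (kf1 i).
  exists [ffun i => - h i]; apply/ffunP=> a; rewrite !ffunE mulmxN mulNmx opprK.
  apply: (Bfree (tgt a)).
  have := congr1 (mulmx (E (src a))) (hf1 a).
  rewrite !mulmxDr !mulmxA hh EX (_ : E _ *m f _ = 0);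
    last by rewrite fE mulmxA EC mul0mx.
  rewrite mul0mx addr0 -(mulmxA (N a)) hh -(mulmxA (h _)) BX ffunE fE !mulmxA
    EE' mul1mx.
  rewrite -(mulmxA (Z a)) C'C mulmx1 => h1.
  by rewrite mulmxDl mulNmx -h1 addrC addrK.
exists [ffun a => J a], [ffun a => R a] => Z.
(* A direction inducing the cocycle Z from im f to X / im f. *)
pose Y : rep K d := [ffun a => B' (src a) *m Z a *m P' (tgt a)].
have [f1 hf1 kf1] := lift Y.
pose k i := C' i *m f1 i *m P i.
have fk i : f1 i *m P i = C i *m k i.
  rewrite /k -mulmxA; apply: (biprod_factorr (bpC i)).
  have [h hh] := lift_ker i (f1 i) (kf1 i).
  by rewrite mulmxA hh -mulmxA BP mulmx0.
clearbody k.
exists [ffun i => k i]; apply/ffunP=> a; rewrite !ffunE.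
apply: (Cfull (src a)).
have := congr1 (mulmx^~ (P (tgt a))) (hf1 a).
rewrite !mulmxDl -!mulmxA XP fk (mulmxA (f1 _)) fk (mulmxA (X a)) XC.
rewrite (_ : f _ *m P _ = 0); last by rewrite fE -mulmxA BP mulmx0.
rewrite mulmx0 add0r ffunE fE -!mulmxA P'P mulmx1 (mulmxA (B _)) BB' mul1mx =>
  h1.
by rewrite mulmxBr h1 addrC addKr.
Qed.

End Endomorphisms.

(** * Splitting a dimension vector that is not a Schur root *)
Section MinimalEnd.
Variables (K : closedFieldType) (Q : quiver).
Implicit Types b c d e x : dimvec Q.

Lemma hom_id d (X : rep K d) : vmap_id K d \in hom X X.
Proof. by apply/homP=> a; rewrite !ffunE mulmx1 mul1mx. Qed.

Lemma lift_of_defect d (X Y : rep K d) (f f1 : vmap K d d) :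
  defect X X f1 + defect Y Y f = 0 -> first_order_lift X Y f f1.
Proof.
move=> /ffunP h a; have := h a; rewrite !(mxfamDE, ffunE) => /eqP.
by rewrite addrACA -opprD subr_eq0 addrC => /eqP.
Qed.

(** The endomorphism rings on the line X + s Y are kernels of a pencil, of
    constant dimension near s = 0 by minimality. *)
Lemma minimal_end_lift d (X Y : rep K d) (f : vmap K d d) :
  (forall Z : rep K d, \dim (hom X X) <= \dim (hom Z Z))%N ->
  f \in hom X X -> exists f1, first_order_lift X Y f f1.
Proof.
move=> minX fX.
have dk s : (1 : {poly K}).[s] != 0 -> (\dim (lker (linfun (defect X X))) <=
    \dim (lker (linfun (defect X X) + s *: linfun (defect Y Y))%R))%N.
  by move=> _; rewrite -defect_pencil; apply: minX.
have [n [g [_ g1 _]]] := ker_pencil_lift (oner_neq0 _) dk fX.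
exists (g 1%N); apply: lift_of_defect.
by rewrite -g1 !lfunE.
Qed.

Lemma idempotent_lift_zmod (V : zmodType) (A B C D E F : V) :
  E + (A + B - C + (D + C - E) - F) = A + D - F + B.
Proof.
rewrite (addrC D C) -(addrA C) [A + B - C + _]addrA subrK [E + _]addrC.
by rewrite (addrA (A + B)) [LHS]addrAC subrK [RHS]addrAC (addrAC A).
Qed.

Definition idempotent_end d (X : rep K d) (e : vmap K d d) :=
  e \in hom X X /\ forall i, e i *m e i = e i.

(** The lift f1 of the idempotent e is replaced by e f1 + f1 e - 2 e f1 e, its
    component mixing ker e and im e; it is the derivative of
    3 g^2 - 2 g^3 at g = e in the direction f1, and it maps ker e into im e. *)
Lemma ext0_of_idempotent d (X : rep K d) (e : vmap K d d) :
  (forall Z : rep K d, \dim (hom X X) <= \dim (hom Z Z))%N ->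
  idempotent_end X e ->
  ext K (corank_vec e) (rank_vec e) = 0 /\ ext K (rank_vec e) (corank_vec e)
    = 0.
Proof.
move=> minX [eX ee]; apply: (ext0_of_lifts eX) => Y.
have [f1 hf1] := minimal_end_lift Y minX eX; move/homP: eX => eX.
exists [ffun i => e i *m f1 i + f1 i *m e i
  - (e i *m f1 i *m e i + e i *m f1 i *m e i)]; last first.
  move=> i; rewrite ffunE mulmxBr !mulmxDr !mulmxA mulmx_ker !mul0mx.
  by rewrite addr0 subr0 add0r submxMl.
move=> a; have := hf1 a; rewrite !ffunE.
move: (e (src a)) (e (tgt a)) (f1 (src a)) (f1 (tgt a)) (ee (src a))
  (ee (tgt a)) (eX a).
move: (X a) (Y a) => x y p q u v pp qq xq h.
have {h}xv : x *m v = u *m x + p *m y - y *m q.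
  by apply/eqP; rewrite eq_sym subr_eq -h addrC.
have e1 : x *m (q *m v) = p *m u *m x + p *m y - p *m y *m q.
  by rewrite mulmxA xq -mulmxA xv mulmxBr mulmxDr !mulmxA pp.
have e2 : x *m (v *m q) = u *m p *m x + p *m y *m q - y *m q.
  by rewrite mulmxA xv mulmxBl mulmxDl -(mulmxA u x) xq -(mulmxA y q) qq
    !mulmxA.
have e3 : x *m (q *m v *m q) = p *m u *m p *m x.
  transitivity (x *m q *m (v *m q)); first by rewrite !mulmxA.
  rewrite xq -(mulmxA p x) e2.
  by rewrite mulmxBr mulmxDr !mulmxA pp addrK.
rewrite mulmxBr !mulmxDr e1 e2 e3 mulmxBl !mulmxDl.
exact: idempotent_lift_zmod.
Qed.

End MinimalEnd.

Section Fitting.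
Variables (K : closedFieldType) (Q : quiver).
Implicit Types b c d e x : dimvec Q.

(** The projector onto the image of a power of g of minimal rank. *)
Lemma fitting_idempotent d (X : rep K d) (g : vmap K d d) : g \in hom X X ->
  exists (e : vmap K d d) (n : nat), [/\ idempotent_end X e,
    forall i, e i = 0 -> g i ^+ n = 0 & forall i, e i = 1%:M -> g i \in unitmx].
Proof.
move=> /homP gX.
have gnX n a : X a *m g (tgt a) ^+ n = g (src a) ^+ n *m X a.
  elim: n => [|n IH]; first by rewrite !expr0 mulmx1 mul1mx.
  rewrite !exprS -[_ * _]/(_ *m _) mulmxA gX -mulmxA IH mulmxA.
  by rewrite -[_ *m _ ^+ n]/(_ * _ ^+ n).
pose S r := `[< exists n, r = (\sum_i \rank (g i ^+ n.+1))%N >].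
have exS : exists r, S r.
  by exists (\sum_i \rank (g i ^+ 1))%N; apply/asboolP; exists 0%N.
case: (ex_minnP exS) => r; move=> /asboolP[n ->] minr.
pose G i := g i ^+ n.+1.
have rG i : \rank (G i *m G i) = \rank (G i).
  apply: (@sum_leq_eq _ (fun i => \rank (G i *m G i)) (fun i => \rank (G i))).
    by move=> j; apply: mxrankM_maxl.
  apply: minr; apply/asboolP; exists (n + n.+1)%N.
  apply: eq_bigr => j _; congr (\rank _).
  by rewrite /G -[LHS]/(_ * _) -exprD addSn.
have /fin_all_exists[H /fin_all_exists[H' hH]] i := rank_square_factor (rG i).
have GH i : G i *m H i = H' i *m G i.
  have [h1 h2] := hH i; rewrite {1}h2 -[LHS]mulmxA; congr (_ *m _).
  by rewrite -h1.
have GX a : X a *m G (tgt a) = G (src a) *m X a by apply: gnX.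
have Ge i : G i *m (G i *m H i) = G i by rewrite mulmxA; case: (hH i).
have eG i : G i *m H i *m G i = G i by rewrite GH -mulmxA; case: (hH i).
exists [ffun i => G i *m H i], n.+1; split=> [|i|i]; rewrite ?ffunE;
  first split.
- apply/homP=> a; rewrite !ffunE.
  transitivity (G (src a) *m H (src a) *m X a *m (G (tgt a) *m H (tgt a))).
    rewrite -(mulmxA _ (X a)) (mulmxA (X a)) GX -(mulmxA _ (X a)).
    by rewrite (mulmxA (G (src a) *m H (src a))) eG mulmxA -GX.
  by rewrite GH -!(mulmxA (H' (src a))) -GX -(mulmxA (X a)) Ge.
- by move=> i; rewrite ffunE mulmxA eG.
- by move=> e0; rewrite -/(G i) -(eG i) e0 mul0mx.
move=> e1; have : g i *m (g i ^+ n *m H i) = 1%:M.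
  by rewrite mulmxA -[g i *m _]/(g i * _) -exprS.
by case/mulmx1_unit.
Qed.

(** Without nontrivial idempotents f has a single eigenvalue l on all vertices,
    and tr (f i0) = l (d i0); in characteristic 0 this vanishes only when
    l = 0, and then f is nilpotent. *)
Lemma traceless_singular d (X : rep K d) (f : vmap K d d) i0 :
  [pchar K] =i pred0 -> d i0 != 0%N ->
  (forall e : vmap K d d, idempotent_end X e -> e = 0 \/ e = vmap_id K d) ->
  f \in hom X X -> \tr (f i0) = 0 -> f i0 \notin unitmx.
Proof.
move=> ch0 di0 noid fX tr0.
have [l hl] : exists l, root (char_poly (f i0)) l.
  by apply/closed_rootP; rewrite size_char_poly eqSS.
have nl : f i0 - l%:M \notin unitmx.
  move: hl; rewrite -eigenvalue_root_char => /eigenvalueP[v vf v0].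
  apply/negP => u; case/eqP: v0; rewrite -[v](mulmxK u) mulmxBr vf.
  by rewrite mul_mx_scalar subrr mul0mx.
pose g : vmap K d d := f - l *: vmap_id K d.
have gE i : g i = f i - l%:M.
  by rewrite mxfamDE ffunE mxfamZE ffunE scalemx1.
have gX : g \in hom X X by rewrite rpredB // rpredZ // hom_id.
have [e [n [eI e0 e1]]] := fitting_idempotent gX.
case: (noid e eI) => ee; last first.
  by case/negP: nl; rewrite -gE; apply: e1; rewrite ee ffunE.
have gn : g i0 ^+ n = 0 by apply: e0; rewrite ee ffunE.
have := mxtrace_nilpotent gn; rewrite gE raddfB /= tr0 sub0r mxtrace_scalar =>
  /eqP.
rewrite oppr_eq0 -mulr_natr mulf_eq0 ((pcharf0P K).1 ch0) => /orP[/eqP l0|].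
  by move: nl; rewrite l0 raddf0 subr0.
by rewrite (negPf di0).
Qed.

End Fitting.

Section TracelessEndomorphisms.
Variables (K : closedFieldType) (Q : quiver).
Implicit Types b c d e x : dimvec Q.

Section AtVertex.
Variables (d : dimvec Q) (i0 : vertex Q).

Definition trace_at (f : vmap K d d) : K^o := \tr (f i0).
Fact trace_at_linear : linear trace_at.
Proof. by move=> a f g;
  rewrite /trace_at mxfamDE mxfamZE raddfD /= mxtraceZ. Qed.
HB.instance Definition _ :=
  GRing.isLinear.Build K _ _ _ trace_at trace_at_linear.

Notation target := (mxfam K (fun a : arrow Q => d (src a)) (fun a =>
  d (tgt a))).

(** The endomorphisms of X with trace 0 at i0 form the kernel for z = 1; the
    value z = 0 serves for the direction of a pencil, on which the trace
    condition is constant. *)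
Definition defect_trace (X : rep K d) (z : K) (f : vmap K d d)
  : (target * K^o)%type :=
  (defect X X f, z *: trace_at f).
Fact defect_trace_linear X z : linear (defect_trace X z).
Proof.
by move=> a f g; rewrite /defect_trace !linearP.
Qed.
HB.instance Definition _ X z :=
  GRing.isLinear.Build K _ _ _ (defect_trace X z) (defect_trace_linear X z).

Definition end0 (X : rep K d) := lker (linfun (defect_trace X 1)).

Lemma end0P X f : f \in end0 X <-> f \in hom X X /\ \tr (f i0) = 0.
Proof.
rewrite memv_ker lfunE /= /defect_trace scale1r xpair_eqE memv_ker lfunE /=.
by split=> [/andP[-> /eqP] | [-> /eqP]].
Qed.

Lemma dim_end0 X : [pchar K] =i pred0 -> d i0 != 0%N ->
  (\dim (end0 X)).+1 = \dim (hom X X).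
Proof.
move=> ch0 di0; rewrite -(limg_ker_dim (linfun trace_at) (hom X X)) -addn1.
congr (\dim _ + _)%N.
  apply/vspaceP=> f; have E : (f \in lker (linfun trace_at))
    = (\tr (f i0) == 0).
    by rewrite memv_ker lfunE.
  rewrite memv_cap E.
  apply/idP/andP => [/end0P[-> ->]|[fX /eqP tf]]; first by rewrite eqxx.
  by apply/end0P.
apply/eqP; rewrite eqn_leq; apply/andP; split; last first.
  by apply: leq_trans (dimvS (subvf _)) _; rewrite dimvf.
rewrite lt0n dimv_eq0; apply/eqP => h0.
have : linfun trace_at (vmap_id K d) \in (linfun trace_at @: hom X X)%VS.
  exact/memv_img/hom_id.
rewrite h0 memv0 lfunE /= /trace_at ffunE mxtrace_scalar -mulr_natr mul1r.
by rewrite ((pcharf0P K).1 ch0) (negPf di0).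
Qed.

Lemma end0_pencil X Y s :
  linfun (defect_trace (X + s *: Y) 1)
    = linfun (defect_trace X 1) + s *: linfun (defect_trace Y 0).
Proof.
apply/lfunP=> f; rewrite add_lfunE scale_lfunE !lfunE /= /defect_trace.
have /lfunP/(_ f) := defect_pencil X Y X Y s.
rewrite add_lfunE scale_lfunE !lfunE /= => ->.
by rewrite -[RHS]/(_ + _, _ + _) /= scale0r scaler0 addr0.
Qed.

Definition minimal_end (X : rep K d) :=
  forall Z : rep K d, (\dim (hom X X) <= \dim (hom Z Z))%N.

(** A traceless endomorphism f extends to a polynomial family gg s of traceless
    endomorphisms on the line X + s Y.  By maximality the rank of gg s at every
    vertex is that of f for general s, so [rank_tangent] applies. *)
Lemma max_rank_lift (X Y : rep K d) (f : vmap K d d) :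
  [pchar K] =i pred0 -> d i0 != 0%N -> minimal_end X -> f \in end0 X ->
  (forall (Z : rep K d) g, minimal_end Z -> g \in end0 Z ->
     \sum_i \rank (g i) <= \sum_i \rank (f i))%N ->
  exists2 f1, first_order_lift X Y f f1 & forall i, (kermx (f i) *m f1 i
    <= f i)%MS.
Proof.
move=> ch0 di0 minX fX maxf.
have dk s : (1 : {poly K}).[s] != 0 -> (\dim (end0 X) <= \dim (lker
    (linfun (defect_trace X 1) + s *: linfun (defect_trace Y 0))%R))%N.
  by move=> _; rewrite -end0_pencil -ltnS -/(end0 _) !dim_end0.
have [n [g [g0 g1 gs]]] := ker_pencil_lift (oner_neq0 _) dk fX.
have [q q0 hq] := hom_generic X Y X Y 0.
pose P i : 'M[{poly K}]_(d i) := \sum_(k < n.+2) 'X^k *: map_mx polyC (g k i).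
pose gg s : vmap K d d := \sum_(k < n.+2) s ^+ k *: g k.
have mxfam_sumE (r : nat) (F : 'I_r -> vmap K d d) i : (\sum_k F k) i
  = \sum_k F k i.
  by elim/big_rec2: _ => [|k y1 y2 _ <-]; rewrite ?mxfamDE ?ffunE.
have evP s i : ev s (P i) = gg s i.
  rewrite /gg mxfam_sumE /P raddf_sum; apply: eq_bigr => k _.
  by rewrite /= map_mxZ ev_cst /= /horner_eval hornerXn mxfamZE.
have gs0 : gg 0 = f.
  rewrite /gg big_ord_recl expr0 scale1r g0 big1 ?addr0 // => k _.
  by rewrite exprS mul0r scale0r.
have cfP0 i : cf 0 (P i) = f i by rewrite -ev0_cf evP gs0.
have cfP1 i : cf 1 (P i) = g 1%N i.
  rewrite /P raddf_sum big_ord_recl big_ord_recl /=.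
  have cX (k : nat) (A : 'M[K]_(d i)) : cf 1 ('X^k *: map_mx polyC A)
    = (k == 1%N)%:R *: A.
    apply/matrixP=> a b; rewrite !mxE /= mulrC coefCM coefXn mulrC.
    by rewrite eq_sym.
  rewrite !cX scale0r add0r scale1r big1 ?addr0 // => k _.
  by rewrite cX scale0r.
have minE s : q.[s] != 0 -> minimal_end (X + s *: Y).
  by move=> /hq; rewrite !line_start => h Z; apply: leq_trans h (minX Z).
have /fin_all_exists2[p p0 hp] i := rank_generic (P i) 0.
pose pp := q * \prod_i p i.
have pp0 : pp != 0.
  rewrite mulf_neq0 ?(horner_neq0 q0) //; apply/prodf_neq0 => i _.
  exact: horner_neq0 (p0 i).
have rk i s : pp.[s] != 0 -> (\rank (ev s (P i)) <= \rank (ev 0%R (P i)))%N.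
  rewrite hornerM mulf_eq0 negb_or horner_prod => /andP[qs /prodf_neq0 ps].
  rewrite !evP gs0 -(@sum_leq_eq _ (fun i => \rank (f i)) (fun i =>
    \rank (gg s i))) //.
    by move=> j; rewrite -evP -gs0 -evP; apply: hp; apply: ps.
  apply: maxf (minE s qs) _.
  by rewrite /end0 end0_pencil; apply: gs.
exists (g 1%N).
  apply: lift_of_defect; move: g1; rewrite !lfunE /= /defect_trace.
  by move=> /(congr1 fst) /=.
by move=> i; have := rank_tangent pp0 (rk i); rewrite cfP0 cfP1.
Qed.

End AtVertex.

Lemma end_iso_of_dim1 d (X : rep K d) : d != 0 -> \dim (hom X X)
  = 1%N -> end_iso_K X.
Proof.
move=> d0 h1.
have id0 : vmap_id K d != 0.
  apply: contraNneq d0 => /ffunP id0; apply/eqP/ffunP=> i; rewrite ffunE.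
  have := id0 i; rewrite !ffunE; case: (d i) => // n /matrixP/(_ 0 0)/eqP.
  by rewrite !mxE eqxx oner_eq0.
have hX : hom X X = <[vmap_id K d]>%VS.
  apply/eqP; rewrite eq_sym eqEdim -memvE hom_id h1 dim_vline.
  by rewrite id0.
have lin : linear (fun c : K^o => c *: vmap_id K d).
  by move=> a u v; rewrite scalerDl scalerA.
pose F := GRing.isLinear.Build K K^o (vmap K d d) *:%R (fun c
  : K^o => c *: vmap_id K d) lin.
pose Fl : {linear K^o -> vmap K d d} :=
  HB.pack (fun c : K^o => c *: vmap_id K d) F.
exists Fl; split.
- by move=> a b /= /eqP;
    rewrite -subr_eq0 -scalerBl scaler_eq0 (negPf id0) orbF subr_eq0 => /eqP.
- by move=> g; rewrite hX; split=> [/vlineP|] [k ->];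
    [exists k | apply/vlineP; exists k].
- by rewrite /= scale1r.
by move=> a b /=; apply/ffunP=> i;
  rewrite [RHS]ffunE !mxfamZE ffunE -scalemxAl -scalemxAr mulmx1 scalerA.
Qed.

Lemma vec_neq0 d : d != 0 -> exists i, d i != 0%N.
Proof.
move=> d0; apply: contrapT => nex; case/eqP: d0; apply/ffunP=> i; rewrite ffunE.
by apply/eqP/negPn/negP => h; apply: nex; exists i.
Qed.

(** The endomorphism f is a nontrivial idempotent of some representation with
    minimal endomorphism ring if there is one; otherwise it is traceless of
    maximal rank among all such representations, nonzero because the
    endomorphism ring has dimension at least 2. *)
Theorem schur_split d : [pchar K] =i pred0 -> d != 0 -> ~ Schur_root K d ->
  exists b c, [/\ b != 0, c != 0, d = b + c, ext K b c = 0 & ext K c b = 0].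
Proof.
move=> ch0 d0 nS.
suff [X [f [f0 [i nf] [h1 h2]]]] : exists (X : rep K d) (f : vmap K d d),
    [/\ f != 0, exists i, f i \notin unitmx &
     ext K (corank_vec f) (rank_vec f) = 0 /\ ext K (rank_vec f) (corank_vec f)
       = 0].
  exists (rank_vec f), (corank_vec f); split=> //.
  - apply: contraNneq f0 => /ffunP r0; apply/eqP/ffunP=> j; rewrite ffunE.
    by apply/eqP; rewrite -mxrank_eq0; have := r0 j; rewrite !ffunE => ->.
  - apply: contraNneq nf => /ffunP/(_ i); rewrite !ffunE => h.
    have {}h : (d i <= \rank (f i))%N by rewrite -subn_eq0; apply/eqP.
    by rewrite -row_free_unit /row_free eqn_leq h rank_leq_row.
  exact: rank_corank.
have [i0 di0] := vec_neq0 d0.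
pose P (n : nat) := `[< exists X : rep K d, n = \dim (hom X X) >].
have exP : exists n, P n.
  by exists (\dim (hom (0 : rep K d) (0 : rep K d))); apply/asboolP; exists 0.
case: (ex_minnP exP) => h /asboolP[X hX] minh.
have minX : minimal_end X.
  by move=> Z; rewrite -hX; apply: minh; apply/asboolP; exists Z.
have end_gt1 (Z : rep K d) : (1 < \dim (hom Z Z))%N.
  rewrite ltn_neqAle; apply/andP; split.
    by apply/eqP => h1; apply: nS; exists Z; apply: end_iso_of_dim1.
  by rewrite -(dim_end0 Z ch0 di0).
have [[Z [e [minZ eI e0 e1]]]|noid] :=
  pselect (exists (Z : rep K d) (e : vmap K d d),
    [/\ minimal_end Z, idempotent_end Z e, e != 0 & e != vmap_id K d]).
  exists Z, e; split=> //; last exact: (ext0_of_idempotent minZ eI).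
  apply: contrapT => nu; case/eqP: e1; apply/ffunP=> i; rewrite ffunE.
  have u : e i \in unitmx by apply/negPn/negP => h1; apply: nu; exists i.
  have [_ ee] := eI.
  by rewrite -[e i](mulKmx u) ee mulVmx.
pose R (r : nat) := `[< exists (Z : rep K d) (f : vmap K d d),
  [/\ minimal_end Z, f \in end0 i0 Z & r = \sum_i \rank (f i)]%N >].
have exR : exists r, R r.
  by exists (\sum_i \rank ((0 : vmap K d d) i)); apply/asboolP; exists X, 0;
    rewrite mem0v.
have ubR r : R r -> (r <= \sum_i d i)%N.
  move=> /asboolP[Z [f [_ _ ->]]]; apply: leq_sum => i _; exact: rank_leq_row.
case: (ex_maxnP exR ubR) => r /asboolP[Z [f [minZ fZ rE]]] maxr.
have maxf (Z' : rep K d) g : minimal_end Z' -> g \in end0 i0 Z' ->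
    (\sum_i \rank (g i) <= \sum_i \rank (f i))%N.
  by move=> m1 m2; rewrite -rE; apply: maxr; apply/asboolP; exists Z', g.
have [fX tf] := (end0P i0 Z f).1 fZ.
exists Z, f; split.
- have : end0 i0 Z != 0%VS.
    by rewrite -dimv_eq0 -lt0n -ltnS dim_end0.
  rewrite -vpick0; set g := vpick _ => g0.
  have gZ : g \in end0 i0 Z by apply: memv_pick.
  apply: contraNneq g0 => f0; apply/eqP/ffunP=> i; rewrite ffunE.
  have := maxf Z g minZ gZ.
  rewrite [X in (_ <= X)%N]big1 => [|j _]; last by rewrite f0 ffunE mxrank0.
  rewrite leqn0 sum_nat_eq0 => /forallP/(_ i) /=.
  by rewrite mxrank_eq0 => /eqP.
- exists i0; apply: traceless_singular ch0 di0 _ fX tf => e eI.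
  have [e0|e0] := eqVneq e 0; [by left | right].
  apply/eqP/negPn/negP => e1; apply: noid; exists Z, e; split=> //.
by apply: (ext0_of_lifts fX) => Y; apply: max_rank_lift fZ maxf.
Qed.

End TracelessEndomorphisms.

(** * Associativity of the product *)
Section ExactSequences.
Variables (K : fieldType) (Q : quiver).
Implicit Types a b c d e : dimvec Q.

Lemma exact_dim d e c (N : rep K e) (X : rep K d) (M : rep K c) :
  exact_seq N X M -> d = c + e.
Proof.
case/biprod_of_exact_seq=> f [f' [g [g' [bp _ _]]]]; apply/ffunP=> i.
by rewrite ffunE (biprod_dim (bp i)) addnC.
Qed.

(** W is the preimage in X of the subrepresentation N' of the quotient Z. *)
Lemma pull_sub a b c z d (N : rep K c) (X : rep K d) (Z : rep K z)
    (N' : rep K b) (M : rep K a) :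
  exact_seq N X Z -> exact_seq N' Z M ->
  exists W : rep K (b + c), exact_seq W X M /\ exact_seq N W N'.
Proof.
move=> ex1 ex2; have dz := exact_dim ex1; have za := exact_dim ex2.
have [f [f' [g [g' [bp hf hg]]]]] := biprod_of_exact_seq ex1.
have [p [p' [q [q' [bq hp hq]]]]] := biprod_of_exact_seq ex2.
have /fin_all_exists[w /fin_all_exists[w' /fin_all_exists[r bw]]] i :
    exists w w' r, @biprod K ((b + c)%R i) (d i) (a i) w w' (g i *m q i) r.
  apply: biprod_of_full.
    have [_ h1 _ _ _] := bp i; have [_ h2 _ _ _] := bq i.
    apply/row_fullP; exists (q' i *m g' i).
    by rewrite -mulmxA (mulmxA (g' i)) h1 mul1mx.
  have -> : d i = (a i + b i + c i)%N by rewrite dz za !ffunE.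
  by rewrite -addnA addnC; congr addn; rewrite ffunE.
pose W : rep K (b + c) := [ffun x => w (src x) *m X x *m w' (tgt x)].
have WE x : W x = w (src x) *m X x *m w' (tgt x) by exact: ffunE.
have wgq i : w i *m (g i *m q i) = 0 by case: (bw i).
have wX x : w (src x) *m X x = W x *m w (tgt x).
  rewrite WE; apply: (biprod_factorl (bw (tgt x))).
  by rewrite mulmxA -(mulmxA (w _)) hg -!mulmxA hq !mulmxA -(mulmxA (w _)) wgq
    mul0mx.
have fw i : f i *m w' i *m w i = f i.
  have [_ _ h3 _ _] := bp i; rewrite -(biprod_factorl (bw i)) // mulmxA h3.
  by rewrite mul0mx.
pose u i := f i *m w' i; pose v i := w i *m g i *m p' i.
have vp i : w i *m g i = v i *m p i.
  by apply: (biprod_factorl (bq i)); rewrite -mulmxA.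
have pgw i : p i *m g' i *m w' i *m w i = p i *m g' i.
  have [_ h2 _ _ _] := bp i; have [_ _ h3 _ _] := bq i.
  by rewrite -(biprod_factorl (bw i)) // -mulmxA (mulmxA (g' i)) h2 mul1mx.
exists W; split.
  apply: exact_of_biprod bw _ _ => x; first by rewrite wX.
  by rewrite mulmxA hg -mulmxA hq mulmxA.
apply: (@exact_of_biprod _ _ _ _ _ _ _ _ u (fun i => w i *m f' i) v
  (fun i => p i *m g' i *m w' i)).
- move=> i; have [f1 f2 f3 f4 f5] := bp i; have [q1 q2 q3 q4 q5] := bq i.
  have [w1 w2 w3 w4 w5] := bw i; rewrite /u /v; split.
  + by rewrite mulmxA fw.
  + by rewrite !mulmxA pgw -(mulmxA (p i)) f2 mulmx1.
  + by rewrite !mulmxA fw f3 mul0mx.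
  + by rewrite mulmxA pgw -mulmxA f4 mulmx0.
  have -> : w i *m g i *m p' i *m (p i *m g' i *m w' i)
    = w i *m (g i *m g' i) *m w' i.
    by rewrite !mulmxA -/(v i) -vp.
  have -> : w i *m f' i *m (f i *m w' i) = w i *m (f' i *m f i) *m w' i.
    by rewrite !mulmxA.
  by rewrite -mulmxDl -mulmxDr f5 mulmx1.
- move=> x; rewrite /u mulmxA hf -{1}fw -!mulmxA (mulmxA (w _)) wX -!mulmxA.
  by have [-> _ _ _ _] := bw (tgt x); rewrite mulmx1.
move=> x; rewrite {1}/v !mulmxA -wX -(mulmxA (w _)) hg mulmxA vp -mulmxA.
have [q1 _ _ _ _] := bq (tgt x).
by rewrite -(mulmxA (v _)) (mulmxA (p _)) -hp -!mulmxA q1 mulmx1.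
Qed.

(** Z is the quotient of X by the subrepresentation N of W. *)
Lemma push_quotient a b c w0 d (N : rep K c) (X : rep K d) (W : rep K w0)
    (N' : rep K b) (M : rep K a) :
  exact_seq W X M -> exact_seq N W N' ->
  exists Z : rep K (a + b), exact_seq N X Z /\ exact_seq N' Z M.
Proof.
move=> ex1 ex2; have dw := exact_dim ex1; have wb := exact_dim ex2.
have [w [w' [h [h' [bw hw hh]]]]] := biprod_of_exact_seq ex1.
have [u [u' [v [v' [bu hu hv]]]]] := biprod_of_exact_seq ex2.
pose f i := u i *m w i.
have /fin_all_exists[f' /fin_all_exists[g /fin_all_exists[g' bp]]] i :
    exists f' g g', @biprod K (c i) (d i) ((a + b)%R i) (f i) f' g g'.
  apply: biprod_of_free; last first.
    have -> : d i = (a i + (b i + c i))%N by rewrite dw wb !ffunE.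
    by rewrite addnA addnC; congr addn; rewrite ffunE.
  have [h1 _ _ _ _] := bw i; have [h2 _ _ _ _] := bu i.
  apply/row_freeP; exists (w' i *m u' i).
  by rewrite -mulmxA (mulmxA (w i)) h1 mul1mx.
pose Z : rep K (a + b) := [ffun x => g' (src x) *m X x *m g (tgt x)].
have ZE x : Z x = g' (src x) *m X x *m g (tgt x) by exact: ffunE.
have fX x : N x *m f (tgt x) = f (src x) *m X x.
  by rewrite /f mulmxA hu -!mulmxA hw.
have fg i : f i *m g i = 0 by case: (bp i).
have Xg x : X x *m g (tgt x) = g (src x) *m Z x.
  rewrite ZE -mulmxA; apply: (biprod_factorr (bp (src x))).
  by rewrite mulmxA -fX -mulmxA fg mulmx0.
have gg' i : g i *m g' i = 1%:M - f' i *m f i.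
  by have [_ _ _ _ <-] := bp i; rewrite [X in X - _]addrC addrK.
have fh i : f i *m h i = 0.
  by have [_ _ h3 _ _] := bw i; rewrite /f -mulmxA h3 mulmx0.
have fwv i : f i *m (w' i *m v i) = 0.
  have [h1 _ _ _ _] := bw i; have [_ _ h3 _ _] := bu i.
  by rewrite /f mulmxA -(mulmxA (u i)) h1 mulmx1 h3.
have gg'h i : g i *m (g' i *m h i) = h i.
  by rewrite mulmxA gg' mulmxBl mul1mx -mulmxA fh mulmx0 subr0.
have gg'wv i : g i *m (g' i *m (w' i *m v i)) = w' i *m v i.
  by rewrite mulmxA gg' mulmxBl mul1mx -mulmxA fwv mulmx0 subr0.
exists Z; split; first exact: exact_of_biprod bp fX Xg.
apply: (@exact_of_biprod _ _ _ _ _ _ _ _ (fun i => v' i *m w i *m g i)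
  (fun i => g' i *m (w' i *m v i)) (fun i => g' i *m h i) (fun i =>
    h' i *m g i)).
- move=> i; have [f1 f2 f3 f4 f5] := bp i; have [u1 u2 u3 u4 u5] := bu i.
  have [w1 w2 w3 w4 w5] := bw i; split.
  + by rewrite -mulmxA gg'wv -mulmxA (mulmxA (w i)) w1 mul1mx.
  + by rewrite -mulmxA gg'h.
  + by rewrite -mulmxA gg'h -mulmxA w3 mulmx0.
  + by rewrite -mulmxA gg'wv mulmxA w4 mul0mx.
  have wg : w i *m g i = v i *m (v' i *m (w i *m g i)).
    by apply: (biprod_factorr (bu i)); rewrite mulmxA fg.
  have -> : g' i *m (w' i *m v i) *m (v' i *m w i *m g i)
    = g' i *m (w' i *m w i) *m g i.
    by rewrite -!mulmxA -wg.
  have -> : g' i *m h i *m (h' i *m g i) = g' i *m (h i *m h' i) *m g i.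
    by rewrite !mulmxA.
  by rewrite -mulmxDl -mulmxDr w5 mulmx1.
- move=> x; rewrite -(mulmxA _ (g _) (Z x)) -Xg.
  transitivity (v' (src x) *m (w (src x) *m X x) *m g (tgt x));
    last by rewrite !mulmxA.
  rewrite -hw.
  have [u1 u2 u3 u4 u5] := bu (src x); have [t1 t2 t3 t4 t5] := bu (tgt x).
  have : (v' (src x) *m W x - N' x *m v' (tgt x)) *m v (tgt x) = 0.
    by rewrite mulmxBl -!mulmxA hv t2 mulmx1 mulmxA u2 mul1mx subrr.
  move/(biprod_factorl (bu (tgt x))) => /eqP; set k := _ *m u' _.
  rewrite subr_eq => /eqP e1; rewrite (mulmxA (v' _)) e1 !mulmxDl -(mulmxA k).
  by rewrite -(mulmxA k) fg mulmx0 add0r !mulmxA.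
by move=> x; rewrite ZE -!mulmxA gg'h hh.
Qed.

End ExactSequences.

(** * Words in the composition monoid *)
Section Monoid.
Variables (K : closedFieldType) (Q : quiver).
Implicit Types a b c d e : dimvec Q.
Implicit Types A B C : repset K Q.

(** Membership for a representation whose dimension vector is only
    propositionally that of A; no casts along sums of dimension vectors are
    needed. *)
Definition in_repset A d (X : rep K d) : Prop := exists2 S, A
  = existT _ d S & S X.

Lemma existT_inj2 (T : Type) (P : T -> Type) t (y z : P t) :
  existT P t y = existT P t z -> y = z.
Proof.
move=> h; have := projT2_eq h.
by have -> : projT1_eq h = erefl by apply: Prop_irrelevance.
Qed.

Lemma in_repsetE d S (X : rep K d) : in_repset (existT _ d S) X <-> S X.
Proof. by split=> [[S' e S'X] | SX]; [rewrite (existT_inj2 e) | exists S]. Qed.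

Lemma in_repset_proj A (M : rep K (projT1 A)) : projT2 A M -> in_repset A M.
Proof. by case: A M => d S M SM; exists S. Qed.

Lemma repset_ext A B : projT1 A = projT1 B ->
  (forall d (X : rep K d), in_repset A X <-> in_repset B X) -> A = B.
Proof.
case: A B => [d S] [d' S'] /= dd; subst d' => h; congr existT.
apply/funext=> X; apply/propext.
by split=> SX; apply/in_repsetE/h/in_repsetE.
Qed.

Lemma in_star A B d (X : rep K d) : in_repset (star A B) X <->
  exists a b (M : rep K a) (N : rep K b),
    [/\ in_repset A M, in_repset B N & exact_seq N X M].
Proof.
split=> [[S h SX] | [a [b [M [N [[S1 -> S1M] [S2 -> S2N] ex]]]]]].
  have dE : d = projT1 A + projT1 B by have := congr1 (@projT1 _ _) h;
    rewrite /= => ->.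
  subst d; have hS := existT_inj2 h; rewrite -hS in SX.
  case: SX => M [N [AM BN ex]]; exists (projT1 A), (projT1 B), M, N.
  by split=> //; apply: in_repset_proj.
have dE := exact_dim ex; subst d; apply/in_repsetE.
by exists M, N.
Qed.

Lemma star_assoc A B C : star (star A B) C = star A (star B C).
Proof.
apply: repset_ext => [|d X]; first by rewrite /= addrA.
split=> /in_star[a [b [M [N [hM hN ex]]]]]; apply/in_star.
  move/in_star: hM => [a' [b' [M' [N' [hM' hN' ex']]]]].
  have [W [ex1 ex2]] := pull_sub ex ex'.
  exists a', (b' + b), M', W; split=> //; apply/in_star.
  by exists b', b, N', N.
move/in_star: hN => [a' [b' [M' [N' [hM' hN' ex']]]]].
have [Z [ex1 ex2]] := push_quotient ex ex'.
exists (a + a'), b', Z, N'; split=> //; apply/in_star.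
by exists a, a', M, M'.
Qed.

(** In an extension of M by N the subrepresentation is N, of dimension e. *)
Lemma star_full d e : ext K e d = 0 -> star (fullR K d) (fullR K e)
  = fullR K (d + e).
Proof.
move=> ed; congr existT; apply/funext=> X; apply/propext; split=> // _.
have [|N [M ex]] := subrep_of_ext0 _ ed X; last by exists M, N.
by move=> i; rewrite ffunE addnC.
Qed.

Lemma ext0l d : ext K 0 d = 0.
Proof.
apply/eqP; rewrite eq_le ext_ge0 andbT
  (le_trans (ext_le (0 : rep K 0) (0 : rep K d))) //.
by rewrite /codim_defect big1 // => a _; rewrite ffunE mul0n.
Qed.

Lemma ext0r d : ext K d 0 = 0.
Proof.
apply/eqP; rewrite eq_le ext_ge0 andbT
  (le_trans (ext_le (0 : rep K d) (0 : rep K 0))) //.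
by rewrite /codim_defect big1 // => a _; rewrite ffunE muln0.
Qed.

Notation prodR ds := (\big[@star K Q / fullR K 0]_(d <- ds) fullR K d).

Lemma prodR_cat ds es : star (prodR ds) (prodR es) = prodR (ds ++ es).
Proof.
elim: ds => [|d ds IH]; last by rewrite cat_cons !big_cons star_assoc IH.
rewrite big_nil /=; case: es => [|e es].
  by rewrite big_nil star_full ?addr0 // ext0l.
by rewrite big_cons -star_assoc star_full ?ext0r // add0r.
Qed.

Lemma prodR1 d : prodR [:: d] = fullR K d.
Proof. by rewrite big_cons big_nil star_full ?addr0 // ext0l. Qed.

Lemma prodR_merge l r d e : ext K e d = 0 ->
  prodR (l ++ d :: e :: r) = prodR (l ++ (d + e) :: r).
Proof.
by move=> ed; rewrite -!prodR_cat !big_cons -(star_assoc (fullR K d)) star_full.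
Qed.

Lemma dim_prodR ds : projT1 (prodR ds) = \sum_(d <- ds) d.
Proof. by elim: ds => [|d ds IH]; rewrite ?big_nil // !big_cons /= IH. Qed.

Lemma sigma_neq0 (i : vertex Q) : sigma i != 0.
Proof. by apply/eqP => /ffunP/(_ i); rewrite !ffunE eqxx. Qed.

Lemma comp_monoid_prodR A : comp_monoid A ->
  exists2 ds, A = prodR ds & all (predC1 0) ds.
Proof.
elim=> [|i|{}A B _ [ds -> hds] _ [es -> hes]].
- by exists [::]; rewrite ?big_nil.
- by exists [:: sigma i]; rewrite ?prodR1 //= sigma_neq0.
by exists (ds ++ es); rewrite ?prodR_cat // all_cat hds.
Qed.

Definition sext d e : int := ext K d e + ext K e d.
Definition sext_seq d (l : seq (dimvec Q)) : int := \sum_(e <- l) sext d e.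
Fixpoint total_ext (l : seq (dimvec Q)) : int :=
  if l is d :: l' then sext_seq d l' + total_ext l' else 0.

Lemma sextC d e : sext d e = sext e d.
Proof. exact: addrC. Qed.

Lemma sext_seq_mid a l d r : sext_seq a (l ++ d :: r)
  = sext a d + sext_seq a (l ++ r).
Proof. by rewrite /sext_seq !big_cat big_cons /= addrCA. Qed.

Lemma total_ext_mid d l r :
  total_ext (l ++ d :: r) = sext_seq d (l ++ r) + total_ext (l ++ r).
Proof.
elim: l => //= a l ->.
by rewrite sext_seq_mid addrACA (sextC a) [in RHS]/sext_seq big_cons.
Qed.

Lemma total_ext_pair d e l r : total_ext (l ++ d :: e :: r)
  = sext d e + (sext_seq d (l ++ r) + sext_seq e (l ++ r) + total_ext (l ++ r)).
Proof. by rewrite total_ext_mid sext_seq_mid total_ext_mid !addrA. Qed.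

Lemma sext_ge0 d e : 0 <= sext d e.
Proof. by rewrite addr_ge0 // ext_ge0. Qed.

Lemma total_ext_ge0 l : 0 <= total_ext l.
Proof.
elim: l => //= d l IH; rewrite addr_ge0 // sumr_ge0 // => e _; exact: sext_ge0.
Qed.

Lemma sext_seqD_le d e l : sext_seq (d + e) l <= sext_seq d l + sext_seq e l.
Proof.
rewrite /sext_seq -big_split ler_sum // => c _; rewrite /sext /= [leRHS]addrACA.
by rewrite lerD ?extDl_le ?extDr_le.
Qed.

Lemma sext_seqD d e l : ext K d e = 0 -> ext K e d = 0 ->
  sext_seq (d + e) l = sext_seq d l + sext_seq e l.
Proof.
move=> de ed; rewrite /sext_seq -big_split; apply: eq_bigr => c _.
by rewrite /sext /= extDl // extDr // [RHS]addrACA.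
Qed.

Lemma total_ext_merge l r d e : ext K d e <> 0 ->
  total_ext (l ++ (d + e) :: r) < total_ext (l ++ d :: e :: r).
Proof.
move=> de; rewrite total_ext_pair total_ext_mid.
apply: (@le_lt_trans _ _ (sext_seq d (l ++ r) + sext_seq e (l ++ r)
  + total_ext (l ++ r))).
  by rewrite lerD2r sext_seqD_le.
rewrite ltrDr /sext ltr_pwDl ?ext_ge0 // lt_def ext_ge0 andbT.
exact/eqP.
Qed.

Lemma total_ext_split l r d e : ext K d e = 0 -> ext K e d = 0 ->
  total_ext (l ++ (d + e) :: r) = total_ext (l ++ d :: e :: r).
Proof.
move=> de ed; rewrite total_ext_pair total_ext_mid sext_seqD //.
by rewrite /sext de ed !add0r.
Qed.

Definition size_vec d : nat := \sum_i d i.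

Lemma size_le_vec (ds : seq (dimvec Q)) : all (predC1 0) ds ->
  (size ds <= size_vec (\sum_(d <- ds) d)%R)%N.
Proof.
elim: ds => //= d ds IH /andP[d0 /IH h]; rewrite big_cons.
have -> : size_vec (d + \sum_(e <- ds) e)
  = (size_vec d + size_vec (\sum_(e <- ds) e)%R)%N.
  by rewrite /size_vec -big_split; apply: eq_bigr => i _; rewrite ffunE.
rewrite -add1n leq_add // lt0n; apply: contraNneq d0 => /eqP.
rewrite sum_nat_eq0 => /forallP z; apply/eqP/ffunP=> i; rewrite ffunE.
exact/eqP/(z i).
Qed.

Lemma addvec_neq0 d e : d != 0 -> d + e != 0.
Proof.
apply: contraNneq => /ffunP de; apply/eqP/ffunP=> i; rewrite ffunE.
have := de i; rewrite !ffunE => /eqP.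
by rewrite -[_ + _]/(d i + e i)%N addn_eq0 => /andP[/eqP].
Qed.

End Monoid.

Theorem theorem5p8 (K : closedFieldType) (charK : [pchar K] =i pred0)
    (Q : quiver) (acycQ : no_oriented_cycle Q)
    (A : repset K Q) (CA : comp_monoid A) :
  exists ds : seq (dimvec Q),
    [/\ A = \big[@star K Q / fullR K 0]_(d <- ds) fullR K d,
        forall d, d \in ds -> Schur_root K d
      & forall k, (k.+1 < size ds)%N ->
          ext K (nth 0 ds k) (nth 0 ds k.+1) <> 0 ->
          ext K (nth 0 ds k.+1) (nth 0 ds k) <> 0].
Proof.
pose word ds := A = \big[@star K Q / fullR K 0]_(d <- ds) fullR K d
  /\ all (predC1 0) ds.
pose P n := `[< exists2 ds, word ds & n = absz (total_ext K ds) >].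
have exP : exists n, P n.
  have [ds h1 h2] := comp_monoid_prodR CA.
  by exists (absz (total_ext K ds)); apply/asboolP; exists ds.
case: (ex_minnP exP) => n /asboolP[ds0 w0 n0] minn.
pose R m := `[< exists ds, [/\ word ds, n = absz (total_ext K ds) & m = size ds]
  >].
have exR : exists m, R m by exists (size ds0); apply/asboolP; exists ds0.
(* The letters are nonzero and their sum is the dimension vector of A. *)
have ubR m : R m -> (m <= size_vec (projT1 A))%N.
  by move=> /asboolP[ds [[-> nz] _ ->]]; rewrite dim_prodR size_le_vec.
case: (ex_maxnP exR ubR) => m /asboolP[ds [[hA nz] hn hm]] maxm.
exists ds; split=> //.
  move=> d dds; apply: contrapT => nS.
  have d0 : d != 0 := allP nz d dds.
  have [b [c [b0 c0 dbc bc cb]]] := schur_split charK d0 nS.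
  case/splitPr: dds hA nz hn hm => l r hA nz hn hm.
  have : (size (l ++ b :: c :: r) <= m)%N.
    apply: maxm; apply/asboolP; exists (l ++ b :: c :: r); split=> //;
      last first.
      by rewrite -total_ext_split // -dbc.
    split; first by rewrite prodR_merge // -dbc.
    move: nz; rewrite !all_cat /= b0 c0; by case/andP=> -> /andP[_ ->].
  by rewrite hm !size_cat /= !addnS ltnn.
move=> k hk de ed; have hk' := ltnW hk.
set d := nth 0 ds k in de ed; set e := nth 0 ds k.+1 in de ed.
have dsE : ds = take k ds ++ d :: e :: drop k.+2 ds.
  by rewrite -drop_nth // -drop_nth // cat_take_drop.
have /minn : P (absz (total_ext K (take k ds ++ (d + e) :: drop k.+2 ds))).
  apply/asboolP; exists (take k ds ++ (d + e) :: drop k.+2 ds) => //; split.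
    by rewrite -prodR_merge // -dsE.
  move: nz; rewrite {1}dsE !all_cat /= => /andP[-> /and3P[d0 _ ->]].
  by rewrite addvec_neq0.
apply/negP; rewrite -ltnNge hn -ltz_nat !gez0_abs ?total_ext_ge0 //.
by rewrite {3}dsE total_ext_merge.
Qed.
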